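(* Consider an interior grid point $(x_i,y_j)\notin\Gamma$ such that $(x_i^*,y_j^* ):=(x_i-wh,y_j)\in\Gamma_1$ with $0<w<1$ and $(\xi,\zeta)\notin(x_i,y_j)+(-h,h)^2$. Assume that $u_p$ and $f_p$ have uniformly continuous partial derivatives of (total) orders up to three and one, respectively, in $\Omega_p$ for $p=1,2$, and that the one-dimensional functions $\phi_1$ and $\psi_1$ on $\Gamma_1$ have uniformly continuous derivatives of orders up to three and two, respectively. Let $\mathcal{L}_h$ be the discrete operator with stencil coefficients $$C_{0,0}=1,\quad C_{-1,1}=C_{-1,-1}=\frac{(r_4\alpha^2+r_5\alpha)\rho+t_1\alpha^2+t_2\alpha}{\beta},\quad C_{1,1}=C_{1,-1}=\rho,$$ $$C_{0,1}=C_{0,-1}=\frac{(s_1+s_2\alpha^2+s_3\alpha)\rho+t_3+t_4\alpha^2+t_5\alpha}{\beta},$$ $$C_{-1,0}=\frac{(s_4\alpha^2+s_5\alpha)\rho+t_6\alpha^2+t_7\alpha}{\beta},\quad C_{1,0}=\frac{(s_6+s_7\alpha^2+s_8\alpha)\rho+t_8+t_9\alpha^2+t_{10}\alpha}{\beta},$$ where $\alpha:=a_1/a_2>0$, $\beta:=r_1+r_2\alpha^2+r_3\alpha>0$, $\rho\in\mathbb{R}$ is a free parameter, and $$r_1=12(w^3-w^2-w+1),\ r_2=4(w^3+3w^2+2w),\ r_3=4(-4w^3+w+3),\ r_4=4(2w^3+w+3),\ r_5=4(-2w^3-w+3),$$ $$s_1=6(-w^2+2w-1),\ s_2=-6(w^2+2w+1),\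 s_3=12(w^2-1),\ s_4=4(-4w^3+w-3),\ s_5=4(4w^3-w-3),$$ $$s_6=12(-2w^3+3w^2-1),\ s_7=4(-2w^3-3w^2-w),\ s_8=4(8w^3-6w^2+w-3),$$ $$t_1=-4w^3+6w^2-2w,\ t_2=4w^3-6w^2+2w,\ t_3=-6w^3+9w^2-3,\ t_4=-2w^3-3w^2-w,\ t_5=8w^3-6w^2+w-3,$$ $$t_6=8w^3-12w^2-2w,\ t_7=-8w^3+12w^2+2w-6,\ t_8=6(-w^2+2w-1),\ t_9=-6w^2,\ t_{10}=12(w^2-w).$$ Then the compact 9-point finite difference scheme $h^{-1}\mathcal{L}_hu_h=h^{-1}F$ has a third order of consistency at the grid point $(x_i,y_j)$, i.e. $h^{-1}(\mathcal{L}_hu-F)=O(h^3)$ as $h\to0$, where $$F:=\frac1{a_1}\sum_{(m,n)\in\Lambda_1}f_1^{(m,n)}H^{-,w}_{m,n}+\frac1{a_2}\sum_{(m,n)\in\Lambda_1}f_2^{(m,n)}H^{+,w}_{m,n}-\sum_{n=0}^3\phi_1^{(n)}G^w_{0,n}-\frac1{a_1}\sum_{n=0}^2\psi_1^{(n)}G^w_{1,n}.$$ Furthermore, for all positive $a_1,a_2$ and $w\in(0,1)$, the coefficients $\{C_{k,\ell}\}$ satisfy the summation condition $\sum_{k=-1}^1\sum_{\ell=-1}^1C_{k,\ell}=0$ for all $\rho\in\mathbb{R}$, while they satisfy the sign condition ($C_{0,0}>0$ and $C_{k,\ell}\le0$ for all $(k,\ell)\ne(0,0)$) if and only if $\rho$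 belongs to the following nonempty interval: $$\left[\max\left(-\frac{t_3+t_4\alpha^2+t_5\alpha}{s_1+s_2\alpha^2+s_3\alpha},\ -\frac{t_6\alpha^2+t_7\alpha}{s_4\alpha^2+s_5\alpha},\ -\frac{t_8+t_9\alpha^2+t_{10}\alpha}{s_6+s_7\alpha^2+s_8\alpha}\right),\ \min\left(0,\ -\frac{t_1\alpha^2+t_2\alpha}{r_4\alpha^2+r_5\alpha}\right)\right].$$
   Context: **Problem.** Let $l_1<l_2$, $l_3<l_4$ be real with $l_4-l_3=N_0(l_2-l_1)$ for a positive integer $N_0$, let $\Omega=(l_1,l_2)\times(l_3,l_4)$ and $(\xi,\zeta)\in\Omega$. Put $\Gamma_1=\{\xi\}\times(\zeta,l_4)$, $\Gamma_2=\{\xi\}\times(l_3,\zeta)$, $\Gamma_3=(\xi,l_2)\times\{\zeta\}$, $\Gamma_4=(l_1,\xi)\times\{\zeta\}$, $\Gamma=\Gamma_1\cup\Gamma_2\cup\Gamma_3\cup\Gamma_4\cup\{(\xi,\zeta)\}$, and $\Omega_1=(l_1,\xi)\times(\zeta,l_4)$, $\Omega_2=(\xi,l_2)\times(\zeta,l_4)$, $\Omega_3=(\xi,l_2)\times(l_3,\zeta)$, $\Omega_4=(l_1,\xi)\times(l_3,\zeta)$. The coefficient $a$ equals a positive constant $a_p$ on $\Omega_p$; $u_p$ and $f_p$ denote the restrictions of $u$ and $f$ to $\Omega_p$ (with their derivatives extended continuously to $\overline{\Omega_p}$). The function $u$ is the exact solution of the elliptic cross-interface problem $$-\nabla\cdot(a\nabla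 u)=f\ \text{in }\Omega\setminus\Gamma,\quad [u]=\phi_p,\ [a\nabla u\cdot\vec n]=\psi_p\ \text{on }\Gamma_p\ (p=1,2,3,4),\quad u=g\ \text{on }\partial\Omega .$$ On $\Gamma_1,\Gamma_2$ the bracket is the limit $x\to\xi^+$ minus the limit $x\to\xi^-$ and $a\nabla u\cdot\vec n=a\,\partial u/\partial x$; on $\Gamma_3,\Gamma_4$ it is the limit $y\to\zeta^+$ minus the limit $y\to\zeta^-$ and $a\nabla u\cdot\vec n=a\,\partial u/\partial y$. **Mesh.** $x_i=l_1+ih$ ($0\le i\le N_1$), $y_j=l_3+jh$ ($0\le j\le N_2$), $h=(l_2-l_1)/N_1$, $N_2=N_0N_1$; interior grid points are those in $\Omega$. For real stencil coefficients $C_{k,\ell}$, $\mathcal{L}_hu_h:=\sum_{k,\ell=-1}^1C_{k,\ell}(u_h)_{i+k,j+\ell}$ for a grid function $u_h$, and $\mathcal{L}_hu:=\sum_{k,\ell=-1}^1C_{k,\ell}\,u(x_i+kh,y_j+\ell h)$ for the exact solution; for the grid points considered, the values for $k=-1$ are those of $u_1$ and the values for $k=0,1$ are those of $u_2$ (continuous extensions). The scheme $h^{-1}\mathcal{L}_hu_h=h^{-1}F$ has order of consistency $r$ if $h^{-1}(\mathcal{L}_hu-F)=O(h^r)$ as $h\to0$ (with $w,\rho$ fixed, constant independent of $h$ and of the grid point satisfying the stated conditions). **Notation.** At $(x_i^*,y_j^* )\in\Gamma_1$: $f_p^{(m,n)}=\frac{\partial^{m+n}f_p}{\partial x^m\partial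 y^n}(x_i^*,y_j^* )$, $\phi_1^{(n)}=\frac{d^n}{dy^n}\phi_1(\xi,y)|_{y=y_j^*}$, $\psi_1^{(n)}=\frac{d^n}{dy^n}\psi_1(\xi,y)|_{y=y_j^*}$. $\Lambda_M=\{(m,n)\in\mathbb{Z}_{\ge0}^2: m+n\le M\}$. For nonnegative integers $m,n$, $$G_{m,n}(x,y)=\sum_{\ell=0}^{\lfloor n/2\rfloor}\frac{(-1)^\ell x^{m+2\ell}y^{n-2\ell}}{(m+2\ell)!(n-2\ell)!},\qquad H_{m,n}(x,y)=\sum_{\ell=1}^{1+\lfloor n/2\rfloor}\frac{(-1)^\ell x^{m+2\ell}y^{n-2\ell+2}}{(m+2\ell)!(n-2\ell+2)!},$$ $$G^w_{m,n}=\sum_{\ell=-1}^1C_{-1,\ell}G_{m,n}(wh-h,\ell h),\quad H^{-,w}_{m,n}=\sum_{\ell=-1}^1C_{-1,\ell}H_{m,n}(wh-h,\ell h),\quad H^{+,w}_{m,n}=\sum_{k=0}^1\sum_{\ell=-1}^1C_{k,\ell}H_{m,n}(wh+kh,\ell h).$$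
   Formalization: The third-order partial derivatives of u_1 and u_2 are additionally assumed Lipschitz on Ω_1 and Ω_2; with uniform continuity alone the claim fails (a=1, u=|x-ξ|^{7/2}, w=1/2, ρ=0 gives order 5/2). *)

(* Defs.v *)
From Stdlib Require Export Reals Factorial.
From Coquelicot Require Export Coquelicot.

Set Implicit Arguments.
Unset Strict Implicit.
Unset Printing Implicit Defensive.

Open Scope R_scope.

(** * Geometry *)

Record cross_domain := CrossDomain {
  l1 : R; l2 : R; l3 : R; l4 : R;
  N0 : nat;
  xi : R; zeta : R;
  l1_lt_l2 : l1 < l2;
  l3_lt_l4 : l3 < l4;
  N0_pos : (0 < N0)%nat;
  aspect_ratio : l4 - l3 = INR N0 * (l2 - l1);
  xi_in : l1 < xi < l2;
  zeta_in : l3 < zeta < l4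
}.

(* Labels shared by the subdomains Omega_p and the interface pieces Gamma_p. *)
Inductive label := P1 | P2 | P3 | P4.

Definition in_open (D : cross_domain) (x y : R) : Prop :=
  l1 D < x < l2 D /\ l3 D < y < l4 D.

Definition in_boundary (D : cross_domain) (x y : R) : Prop :=
  (l1 D <= x <= l2 D /\ l3 D <= y <= l4 D) /\ ~ in_open D x y.

Definition Omega (D : cross_domain) (p : label) (x y : R) : Prop :=
  match p with
  | P1 => l1 D < x < xi D /\ zeta D < y < l4 D
  | P2 => xi D < x < l2 D /\ zeta D < y < l4 D
  | P3 => xi D < x < l2 D /\ l3 D < y < zeta D
  | P4 => l1 D < x < xi D /\ l3 D < y < zeta D
  end.

Definition Gamma_piece (D : cross_domain) (p : label) (x y : R) : Prop :=
  match p with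
  | P1 => x = xi D /\ zeta D < y < l4 D
  | P2 => x = xi D /\ l3 D < y < zeta D
  | P3 => xi D < x < l2 D /\ y = zeta D
  | P4 => l1 D < x < xi D /\ y = zeta D
  end.

Definition Gamma (D : cross_domain) (x y : R) : Prop :=
  (exists p, Gamma_piece D p x y) \/ (x = xi D /\ y = zeta D).

(** * Regularity *)

Definition unif_continuous_2d (A : R -> R -> Prop) (F : R -> R -> R) : Prop :=
  forall eps : posreal, exists delta : posreal, forall x y x' y' : R,
    A x y -> A x' y' -> Rabs (x - x') < delta -> Rabs (y - y') < delta ->
    Rabs (F x y - F x' y') < eps.

(* Required of the third derivatives of u_1 and u_2, so that the Taylor
   remainder is O(h^4).  Their uniform continuity alone gives o(h^3), and third
   order consistency then fails: a = 1, u(x, y) = |x - xi|^(7/2), w = 1/2,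
   rho = 0 has truncation error of exact order 5/2. *)
Definition lipschitz_2d (A : R -> R -> Prop) (F : R -> R -> R) : Prop :=
  exists L : R, forall x y x' y' : R, A x y -> A x' y' ->
    Rabs (F x y - F x' y') <= L * (Rabs (x - x') + Rabs (y - y')).

(* [ex_diff_n] gives existence and continuity of all mixed partial derivatives
   of order at most [n], in every order of differentiation. *)
Definition unif_smooth_2d (A : R -> R -> Prop) (n : nat) (F : R -> R -> R)
  : Prop :=
  (forall x y, A x y -> ex_diff_n F n x y) /\
  (forall m k, (m + k <= n)%nat -> unif_continuous_2d A (partial_derive m k F)).

Definition unif_smooth_1d (A : R -> Prop) (n : nat) (F : R -> R) : Prop :=
  forall k, (k <= n)%nat ->
    (forall y, A y -> ex_derive_n F k y) /\ uniform_continuity (Derive_n F k) A.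

(* The limit of [F] at [(x, y)] from within [A].  It is total ([lim] of a
   complete space), and meaningful when [(x, y)] is in the closure of [A] and
   [F] is uniformly continuous on [A]. *)
Definition cont_ext (A : R -> R -> Prop) (F : R -> R -> R) (x y : R) : R :=
  lim (filtermap (fun P : R * R => F (fst P) (snd P))
         (within (fun P : R * R => A (fst P) (snd P)) (locally (x, y)))).

(** * The elliptic cross-interface problem *)

Definition has_jump (F : R -> R) (t v : R) : Prop :=
  exists vplus vminus : R,
    filterlim F (at_right t) (locally vplus) /\
    filterlim F (at_left t) (locally vminus) /\
    v = vplus - vminus.

(* Data [phi p], [psi p] are functions of [y] for [p = P1, P2] and of [x] for
   [p = P3, P4]. *)
Definition jump_conditions (D : cross_domain) (a u : R -> R -> R)
    (phi psi : label -> R -> R) (p : label) : Prop :=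
  forall x y, Gamma_piece D p x y ->
  match p with
  | P1 | P2 =>
      has_jump (fun s => u s y) (xi D) (phi p y) /\
      has_jump (fun s => a s y * Derive (fun t => u t y) s) (xi D) (psi p y)
  | P3 | P4 =>
      has_jump (fun s => u x s) (zeta D) (phi p x) /\
      has_jump (fun s => a x s * Derive (fun t => u x t) s) (zeta D) (psi p x)
  end.

Record is_solution (D : cross_domain) (a f g : R -> R -> R)
    (phi psi : label -> R -> R) (u : R -> R -> R) : Prop := IsSolution {
  sol_ex_derive : forall x y, in_open D x y -> ~ Gamma D x y ->
    ex_derive (fun t => u t y) x /\ ex_derive (fun t => u x t) y;
  sol_pde : forall x y, in_open D x y -> ~ Gamma D x y ->
    exists dx dy : R,
      is_derive (fun s => a s y * Derive (fun t => u t y) s) x dx /\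
      is_derive (fun s => a x s * Derive (fun t => u x t) s) y dy /\
      - (dx + dy) = f x y;
  sol_jump : forall p, jump_conditions D a u phi psi p;
  sol_boundary : forall x y, in_boundary D x y -> u x y = g x y;
  (* The boundary values are attained continuously.  The four end points of the
     interface are excluded: there [u] has different limits on the two sides. *)
  sol_trace : forall x y, in_boundary D x y -> x <> xi D -> y <> zeta D ->
    filterlim (fun P : R * R => u (fst P) (snd P))
      (within (fun P : R * R => in_open D (fst P) (snd P)) (locally (x, y)))
      (locally (g x y))
}.

(** * Mesh and discrete operator *)

Definition mesh (D : cross_domain) (N1 : nat) : R := (l2 D - l1 D) / INR N1.
Definition grid_x (D : cross_domain) (N1 i : nat) : R :=
  l1 D + INR i * mesh D N1.
Definition grid_y (D : cross_domain) (N1 j : nat) : R :=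
  l3 D + INR j * mesh D N1.

Definition sum_pm1 (F : Z -> R) : R := F (-1)%Z + F 0%Z + F 1%Z.

(* [v k l] is the value at the stencil point (x_i + k h, y_j + l h). *)
Definition Lh (C : Z -> Z -> R) (v : Z -> Z -> R) : R :=
  sum_pm1 (fun k => sum_pm1 (fun l => C k l * v k l)).

Definition stencil_values (D : cross_domain) (u : R -> R -> R) (N1 i j : nat)
    (k l : Z) : R :=
  cont_ext (Omega D (if (k <? 0)%Z then P1 else P2)) u
    (grid_x D N1 i + IZR k * mesh D N1) (grid_y D N1 j + IZR l * mesh D N1).

(** * The polynomials G, H and the right-hand side F *)

Definition Gpoly (m n : nat) (x y : R) : R :=
  sum_f 0 (n / 2) (fun l =>
    (-1) ^ l * x ^ (m + 2 * l) * y ^ (n - 2 * l)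
    / (INR (fact (m + 2 * l)) * INR (fact (n - 2 * l)))).

(* The exponent is written [n + 2 - 2 * l] because subtraction on [nat]
   truncates. *)
Definition Hpoly (m n : nat) (x y : R) : R :=
  sum_f 1 (1 + n / 2) (fun l =>
    (-1) ^ l * x ^ (m + 2 * l) * y ^ (n + 2 - 2 * l)
    / (INR (fact (m + 2 * l)) * INR (fact (n + 2 - 2 * l)))).

Definition Gw (C : Z -> Z -> R) (w h : R) (m n : nat) : R :=
  sum_pm1 (fun l => C (-1)%Z l * Gpoly m n (w * h - h) (IZR l * h)).

Definition Hw_minus (C : Z -> Z -> R) (w h : R) (m n : nat) : R :=
  sum_pm1 (fun l => C (-1)%Z l * Hpoly m n (w * h - h) (IZR l * h)).

Definition Hw_plus (C : Z -> Z -> R) (w h : R) (m n : nat) : R :=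
  sum_pm1 (fun l => C 0%Z l * Hpoly m n (w * h + 0 * h) (IZR l * h)) +
  sum_pm1 (fun l => C 1%Z l * Hpoly m n (w * h + 1 * h) (IZR l * h)).

(* Sum over the pairs (m, n) with m + n <= M. *)
Definition sum_Lambda (M : nat) (T : nat -> nat -> R) : R :=
  sum_f 0 M (fun m => sum_f 0 (M - m) (fun n => T m n)).

Definition rhs (D : cross_domain) (ap : label -> R) (f : R -> R -> R)
    (phi psi : label -> R -> R) (C : Z -> Z -> R) (w : R) (N1 i j : nat) : R :=
  let h := mesh D N1 in
  let xs := grid_x D N1 i - w * h in
  let ys := grid_y D N1 j in
  let fd p m n := cont_ext (Omega D p) (partial_derive m n f) xs ys in
  / ap P1 * sum_Lambda 1 (fun m n => fd P1 m n * Hw_minus C w h m n)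
  + / ap P2 * sum_Lambda 1 (fun m n => fd P2 m n * Hw_plus C w h m n)
  - sum_f 0 3 (fun n => Derive_n (phi P1) n ys * Gw C w h 0 n)
  - / ap P1 * sum_f 0 2 (fun n => Derive_n (psi P1) n ys * Gw C w h 1 n).

Definition admissible (D : cross_domain) (w : R) (N1 i j : nat) : Prop :=
  let h := mesh D N1 in
  let x := grid_x D N1 i in
  let y := grid_y D N1 j in
  in_open D x y /\ ~ Gamma D x y /\ Gamma_piece D P1 (x - w * h) y /\
  ~ (x - h < xi D < x + h /\ y - h < zeta D < y + h).

Definition consistency_order (D : cross_domain) (ap : label -> R)
    (f : R -> R -> R) (phi psi : label -> R -> R) (u : R -> R -> R)
    (C : Z -> Z -> R) (w : R) (r : nat) : Prop :=
  exists K delta : R, 0 < delta /\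
  forall N1 i j : nat, (0 < N1)%nat -> mesh D N1 < delta ->
    (i <= N1)%nat -> (j <= N0 D * N1)%nat -> admissible D w N1 i j ->
    Rabs (/ mesh D N1 *
          (Lh C (stencil_values D u N1 i j) - rhs D ap f phi psi C w N1 i j))
    <= K * mesh D N1 ^ r.

(** * Stencil coefficients *)

Definition r1 (w : R) := 12 * (w ^ 3 - w ^ 2 - w + 1).
Definition r2 (w : R) := 4 * (w ^ 3 + 3 * w ^ 2 + 2 * w).
Definition r3 (w : R) := 4 * (- 4 * w ^ 3 + w + 3).
Definition r4 (w : R) := 4 * (2 * w ^ 3 + w + 3).
Definition r5 (w : R) := 4 * (- 2 * w ^ 3 - w + 3).

Definition s1 (w : R) := 6 * (- w ^ 2 + 2 * w - 1).
Definition s2 (w : R) := - 6 * (w ^ 2 + 2 * w + 1).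
Definition s3 (w : R) := 12 * (w ^ 2 - 1).
Definition s4 (w : R) := 4 * (- 4 * w ^ 3 + w - 3).
Definition s5 (w : R) := 4 * (4 * w ^ 3 - w - 3).
Definition s6 (w : R) := 12 * (- 2 * w ^ 3 + 3 * w ^ 2 - 1).
Definition s7 (w : R) := 4 * (- 2 * w ^ 3 - 3 * w ^ 2 - w).
Definition s8 (w : R) := 4 * (8 * w ^ 3 - 6 * w ^ 2 + w - 3).

Definition t1 (w : R) := - 4 * w ^ 3 + 6 * w ^ 2 - 2 * w.
Definition t2 (w : R) := 4 * w ^ 3 - 6 * w ^ 2 + 2 * w.
Definition t3 (w : R) := - 6 * w ^ 3 + 9 * w ^ 2 - 3.
Definition t4 (w : R) := - 2 * w ^ 3 - 3 * w ^ 2 - w.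
Definition t5 (w : R) := 8 * w ^ 3 - 6 * w ^ 2 + w - 3.
Definition t6 (w : R) := 8 * w ^ 3 - 12 * w ^ 2 - 2 * w.
Definition t7 (w : R) := - 8 * w ^ 3 + 12 * w ^ 2 + 2 * w - 6.
Definition t8 (w : R) := 6 * (- w ^ 2 + 2 * w - 1).
Definition t9 (w : R) := - 6 * w ^ 2.
Definition t10 (w : R) := 12 * (w ^ 2 - w).

Definition beta (w alpha : R) : R := r1 w + r2 w * alpha ^ 2 + r3 w * alpha.

Definition stencil (w alpha rho : R) (k l : Z) : R :=
  match k, l with
  | 0%Z, 0%Z => 1
  | (-1)%Z, (-1)%Z | (-1)%Z, 1%Z =>
      ((r4 w * alpha ^ 2 + r5 w * alpha) * rho
       + t1 w * alpha ^ 2 + t2 w * alpha) / beta w alpha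
  | 1%Z, (-1)%Z | 1%Z, 1%Z => rho
  | 0%Z, (-1)%Z | 0%Z, 1%Z =>
      ((s1 w + s2 w * alpha ^ 2 + s3 w * alpha) * rho
       + t3 w + t4 w * alpha ^ 2 + t5 w * alpha) / beta w alpha
  | (-1)%Z, 0%Z =>
      ((s4 w * alpha ^ 2 + s5 w * alpha) * rho
       + t6 w * alpha ^ 2 + t7 w * alpha) / beta w alpha
  | 1%Z, 0%Z =>
      ((s6 w + s7 w * alpha ^ 2 + s8 w * alpha) * rho
       + t8 w + t9 w * alpha ^ 2 + t10 w * alpha) / beta w alpha
  | _, _ => 0
  end.

Definition sum_condition (C : Z -> Z -> R) : Prop :=
  sum_pm1 (fun k => sum_pm1 (fun l => C k l)) = 0.

Definition sign_condition (C : Z -> Z -> R) : Prop :=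
  0 < C 0%Z 0%Z /\
  forall k l : Z, (-1 <= k <= 1)%Z -> (-1 <= l <= 1)%Z ->
    ~ (k = 0%Z /\ l = 0%Z) -> C k l <= 0.

Definition rho_min (w alpha : R) : R :=
  Rmax
    (Rmax
      (- ((t3 w + t4 w * alpha ^ 2 + t5 w * alpha)
          / (s1 w + s2 w * alpha ^ 2 + s3 w * alpha)))
      (- ((t6 w * alpha ^ 2 + t7 w * alpha)
          / (s4 w * alpha ^ 2 + s5 w * alpha))))
    (- ((t8 w + t9 w * alpha ^ 2 + t10 w * alpha)
        / (s6 w + s7 w * alpha ^ 2 + s8 w * alpha))).

Definition rho_max (w alpha : R) : R :=
  Rmin 0
    (- ((t1 w * alpha ^ 2 + t2 w * alpha) / (r4 w * alpha ^ 2 + r5 w * alpha))).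

(* Main.v *)
(* Near (xi, y_j) expand u_1 and u_2 in Taylor polynomials of degree 3 centred at
   the interface point; since the third derivatives are Lipschitz, the remainders
   are O(h^4), uniformly up to the closure of Omega_p.  The equation
   u_xx + u_yy = - f / a_p trades every x-derivative of order at least two for
   y-derivatives and data (this is where G and H come from), and the jumps of u
   and a u_x, differentiated along the interface, express the derivatives of u_1
   through those of u_2 and data.  What is left of L_h u - F is a linear
   combination of u_2^(0,n), n <= 3, and u_2^(1,n), n <= 2, whose coefficients
   vanish by symmetry for odd n and by the choice of the stencil for even n.

   The sign statement amounts to polynomial inequalities in alpha > 0 and
   w in (0, 1); after w = x / (1 + x) all coefficients in x > 0 and alpha are
   nonnegative. *)

Require Import Defs.
From Stdlib Require Import Lra Lia.

Set Implicit Arguments.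
Unset Strict Implicit.

(** * Continuous extensions and traces *)

(** [lim] carries information only for a proper Cauchy filter. Uniform continuity gives the Cauchy
    property, and a sequence in [A] tending to the point gives properness. Later facts about
    [cont_ext] can then be obtained as limits along sequences. *)
Lemma is_lim_seq_cont_ext (A : R -> R -> Prop) (F : R -> R -> R) (x y : R)
    (xs ys : nat -> R) :
  unif_continuous_2d A F -> (forall n, A (xs n) (ys n)) ->
  is_lim_seq xs x -> is_lim_seq ys y ->
  is_lim_seq (fun n => F (xs n) (ys n)) (cont_ext A F x y).
Proof.
intros hF hA hx hy.
set (W := within (fun P : R * R => A (fst P) (snd P)) (locally (x, y))).
(* This convergence serves twice: it shows that every set of [W] is inhabited, and it turns the
   limit along [W] into the limit of the sequence. *)
assert (hW : filterlim (fun n => (xs n, ys n)) eventually W).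
{ intros Q [eps hQ].
  assert (ex := hx (ball x eps) (locally_ball x eps)).
  assert (ey := hy (ball y eps) (locally_ball y eps)).
  unfold filtermap in *.
  generalize (filter_and _ _ ex ey); apply filter_imp.
  intros n [hxn hyn]; apply hQ; [split; assumption | apply hA]. }
assert (pW : ProperFilter W).
{ split.
  - intros P hP; destruct (hW P hP) as [n hn].
    exists (xs n, ys n); apply hn; lia.
  - apply within_filter, locally_filter. }
assert (hc : cauchy (filtermap (fun P : R * R => F (fst P) (snd P)) W)).
{ intros eps; destruct (hF eps) as [delta hdelta].
  assert (hd : 0 < delta / 2) by (assert (h := cond_pos delta); lra).
  assert (hb : W (ball (x, y) (mkposreal _ hd))).
  { unfold W, within; generalize (locally_ball (x, y) (mkposreal _ hd)).
    apply filter_imp; auto. }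
  assert (hAW : W (fun P => A (fst P) (snd P))).
  { unfold W, within; apply filter_forall; auto. }
  destruct (filter_ex _ (filter_and _ _ hb hAW)) as [[x0 y0] [[bx0 by0] a0]].
  exists (F x0 y0); unfold filtermap.
  generalize (filter_and _ _ hb hAW); apply filter_imp.
  intros [x1 y1] [[bx1 by1] a1].
  change (Rabs (F x1 y1 - F x0 y0) < eps).
  simpl in *.
  change (Rabs (x0 - x) < delta / 2) in bx0.
  change (Rabs (y0 - y) < delta / 2) in by0.
  change (Rabs (x1 - x) < delta / 2) in bx1.
  change (Rabs (y1 - y) < delta / 2) in by1.
  apply Rabs_def2 in bx0, by0, bx1, by1.
  apply hdelta; try assumption; apply Rabs_def1; lra. }
assert (hl := complete_cauchy _ (filtermap_proper_filter _ _ _ _ pW) hc).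
change (filterlim (fun n => F (xs n) (ys n)) eventually
  (locally (cont_ext A F x y))).
apply filterlim_locally; intros eps.
exact (hW _ (hl eps)).
Qed.

Lemma is_lim_seq_unique_real (v : nat -> R) (p q : R) :
  is_lim_seq v p -> is_lim_seq v q -> p = q.
Proof.
intros hp hq; apply is_lim_seq_unique in hp, hq; congruence.
Qed.

(** The modulus of continuity of [F'] depends on [eps] only, so the mean value theorem on each
    vertical line through [xs n] gives a linearization error bounded uniformly in [n]. The bound
    passes to the limit line, which may lie on the boundary of [A]. *)
Lemma is_derive_cont_ext (A : R -> R -> Prop) (F F' : R -> R -> R) (x y d : R)
    (xs : nat -> R) :
  0 < d -> unif_continuous_2d A F -> unif_continuous_2d A F' ->
  is_lim_seq xs x ->
  (forall n t, Rabs (t - y) < d -> A (xs n) t) ->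
  (forall n t, Rabs (t - y) < d ->
     is_derive (fun t => F (xs n) t) t (F' (xs n) t)) ->
  is_derive (fun t => cont_ext A F x t) y (cont_ext A F' x y).
Proof.
intros hd hF hF' hxs hA hder.
split; [apply is_linear_scal_l |].
intros y' hy'.
assert (e : y = y').
{ apply (is_filter_lim_locally_unique (V := R_NormedModule)); exact hy'. }
subst y'.
intros eps.
destruct (hF' eps) as [delta hdelta].
assert (hm : 0 < Rmin d delta).
{ apply Rmin_pos; [exact hd | apply cond_pos]. }
exists (mkposreal _ hm); intros t ht.
change (Rabs (t - y) < Rmin d delta) in ht.
assert (hty : Rabs (t - y) < d) by (eapply Rlt_le_trans; [exact ht | apply Rmin_l]).
assert (htd : Rabs (t - y) < delta)
  by (eapply Rlt_le_trans; [exact ht | apply Rmin_r]).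
assert (hyy : Rabs (y - y) < d) by (rewrite Rminus_diag, Rabs_R0; exact hd).
change (Rabs (cont_ext A F x t - cont_ext A F x y
  - (t - y) * cont_ext A F' x y) <= eps * Rabs (t - y)).
assert (lim : is_lim_seq
  (fun n => Rabs (F (xs n) t - F (xs n) y - (t - y) * F' (xs n) y))
  (Rabs (cont_ext A F x t - cont_ext A F x y
     - (t - y) * cont_ext A F' x y))).
{ apply (is_lim_seq_abs _ (Finite _)).
  apply is_lim_seq_minus'.
  - apply is_lim_seq_minus'.
    + apply (is_lim_seq_cont_ext (ys := fun _ => t) hF); auto.
      apply is_lim_seq_const.
    + apply (is_lim_seq_cont_ext (ys := fun _ => y) hF); auto.
      apply is_lim_seq_const.
  - apply (is_lim_seq_scal_l _ _ (Finite _)).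
    apply (is_lim_seq_cont_ext (ys := fun _ => y) hF'); auto.
    apply is_lim_seq_const. }
refine (is_lim_seq_le _ _ (Finite _) (Finite _) _ lim (is_lim_seq_const _)).
intros n.
assert (hbetween : forall c, Rmin y t <= c <= Rmax y t ->
  Rabs (c - y) <= Rabs (t - y)).
{ intros c; unfold Rmin, Rmax, Rabs.
  destruct (Rle_dec y t), (Rcase_abs (c - y)), (Rcase_abs (t - y)); lra. }
destruct (MVT_gen (fun t => F (xs n) t) y t (F' (xs n))) as [c [hc ec]].
- intros c hc; apply hder.
  eapply Rle_lt_trans; [apply hbetween; lra | exact hty].
- intros c hc; apply continuity_pt_filterlim.
  apply (ex_derive_continuous (fun t => F (xs n) t)).
  exists (F' (xs n) c); apply hder.
  eapply Rle_lt_trans; [apply hbetween; lra | exact hty].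
- rewrite ec.
  replace (F' (xs n) c * (t - y) - (t - y) * F' (xs n) y)
    with ((F' (xs n) c - F' (xs n) y) * (t - y)) by ring.
  rewrite Rabs_mult; apply Rmult_le_compat_r; [apply Rabs_pos |].
  apply hbetween in hc.
  apply Rlt_le, hdelta.
  + apply hA; lra.
  + apply hA; exact hyy.
  + rewrite Rminus_diag, Rabs_R0; apply cond_pos.
  + lra.
Qed.

(** * Open rectangles and the approach to their boundary from inside *)

Definition rect (b1 b2 c1 c2 : R) (x y : R) : Prop := b1 < x < b2 /\ c1 < y < c2.

Lemma rect_open (b1 b2 c1 c2 x y : R) :
  rect b1 b2 c1 c2 x y -> locally_2d (rect b1 b2 c1 c2) x y.
Proof.
intros [hx hy].
assert (h : 0 < Rmin (Rmin (x - b1) (b2 - x)) (Rmin (y - c1) (c2 - y))).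
{ repeat apply Rmin_pos; lra. }
exists (mkposreal _ h); simpl; intros u v hu hv.
assert (m1 := Rmin_l (Rmin (x - b1) (b2 - x)) (Rmin (y - c1) (c2 - y))).
assert (m2 := Rmin_r (Rmin (x - b1) (b2 - x)) (Rmin (y - c1) (c2 - y))).
assert (m3 := Rmin_l (x - b1) (b2 - x)).
assert (m4 := Rmin_r (x - b1) (b2 - x)).
assert (m5 := Rmin_l (y - c1) (c2 - y)).
assert (m6 := Rmin_r (y - c1) (c2 - y)).
apply Rabs_def2 in hu, hv; split; lra.
Qed.

Lemma locally_open_interval (b1 b2 x : R) : b1 < x < b2 ->
  locally x (fun t => b1 < t < b2).
Proof. intros hx; apply (open_and _ _ (open_gt b1) (open_lt b2)); exact hx. Qed.

(* Tends to [x] from inside [(b1, b2)], also when [x] is an end point. *)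
Definition inner_seq (b1 b2 x : R) (n : nat) : R :=
  x + / (INR n + 2) * ((b1 + b2) / 2 - x).

Lemma inner_seq_in (b1 b2 x : R) (n : nat) :
  b1 < b2 -> b1 <= x <= b2 -> b1 < inner_seq b1 b2 x n < b2.
Proof.
intros hb hx; unfold inner_seq.
assert (hn := pos_INR n).
assert (h0 : 0 < / (INR n + 2)) by (apply Rinv_0_lt_compat; lra).
assert (h1 : / (INR n + 2) < 1).
{ rewrite <- Rinv_1; apply Rinv_lt_contravar; lra. }
nra.
Qed.

Lemma is_lim_seq_inner_seq (b1 b2 x : R) : is_lim_seq (inner_seq b1 b2 x) x.
Proof.
assert (h : is_lim_seq (fun n => / (INR n + 2)) 0).
{ apply (is_lim_seq_inv _ p_infty); [| discriminate].
  apply (is_lim_seq_plus _ _ p_infty 2 p_infty).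
  - apply is_lim_seq_INR.
  - apply is_lim_seq_const.
  - reflexivity. }
unfold inner_seq.
replace (Finite x) with (Finite (x + 0 * ((b1 + b2) / 2 - x)))
  by (f_equal; ring).
apply is_lim_seq_plus'; [apply is_lim_seq_const |].
apply is_lim_seq_mult'; [exact h | apply is_lim_seq_const].
Qed.

(** Differentiation in [y] commutes with the trace on a vertical line, even when that line is a side
    of the rectangle: the line is approached horizontally, with the same sequence at every height
    [t]. *)
Lemma is_derive_trace (b1 b2 c1 c2 : R) (n m k : nat) (F : R -> R -> R)
    (x y : R) :
  b1 < b2 -> b1 <= x <= b2 -> c1 < y < c2 ->
  unif_smooth_2d (rect b1 b2 c1 c2) n F -> (m + S k <= n)%nat ->
  is_derive (fun t => cont_ext (rect b1 b2 c1 c2) (partial_derive m k F) x t) y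
    (cont_ext (rect b1 b2 c1 c2) (partial_derive m (S k) F) x y).
Proof.
intros hb hx hy [hdiff hunif] hn.
set (d := Rmin (y - c1) (c2 - y)).
assert (hin : forall i t, Rabs (t - y) < d ->
  rect b1 b2 c1 c2 (inner_seq b1 b2 x i) t).
{ intros i t ht; split; [apply inner_seq_in; assumption |].
  assert (m1 := Rmin_l (y - c1) (c2 - y)).
  assert (m2 := Rmin_r (y - c1) (c2 - y)).
  apply Rabs_def2 in ht; unfold d in ht; lra. }
apply (is_derive_cont_ext (d := d) (xs := inner_seq b1 b2 x)).
- apply Rmin_pos; lra.
- apply hunif; lia.
- apply hunif; lia.
- apply is_lim_seq_inner_seq.
- exact hin.
- intros i t ht; assert (hr := hin i t ht).
  (* [partial_derive] takes the [y]-derivatives first, so one more of them has to be moved past the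
     [x]-derivatives; this uses [ex_diff_n] on a neighbourhood. *)
  rewrite <- Derive_partial_derive.
  + apply Derive_correct.
    apply (ex_diff_n_ex_deriv_inf_2 n); [lia |].
    apply hdiff; exact hr.
  + generalize (rect_open hr); apply locally_2d_impl, locally_2d_forall.
    intros u v huv; apply (ex_diff_n_m n); [lia | apply hdiff, huv].
Qed.

(** A jump relation valid along an open piece of interface may be differentiated tangentially. The
    case [m = 0] with unit weights serves [phi], the case [m = 1] with the diffusion constants as
    weights serves [psi]. *)
Lemma Derive_n_trace_jump (bm bp b c1 c2 am ap : R) (n m k : nat)
    (u : R -> R -> R) (chi : R -> R) :
  bm < b < bp ->
  unif_smooth_2d (rect bm b c1 c2) n u ->
  unif_smooth_2d (rect b bp c1 c2) n u ->
  (forall y, c1 < y < c2 -> chi y =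
     ap * cont_ext (rect b bp c1 c2) (partial_derive m 0 u) b y
     - am * cont_ext (rect bm b c1 c2) (partial_derive m 0 u) b y) ->
  (m + k <= n)%nat ->
  forall y, c1 < y < c2 -> Derive_n chi k y =
     ap * cont_ext (rect b bp c1 c2) (partial_derive m k u) b y
     - am * cont_ext (rect bm b c1 c2) (partial_derive m k u) b y.
Proof.
intros hb hm hp hchi.
induction k as [| k IH]; intros hn y hy; [exact (hchi y hy) |].
simpl.
erewrite Derive_ext_loc.
2:{ generalize (locally_open_interval hy); apply filter_imp.
    intros t ht; apply IH; [lia | exact ht]. }
apply is_derive_unique.
apply (is_derive_minus (V := R_NormedModule)); apply is_derive_scal.
- apply (is_derive_trace (n := n)); assumption || lra.
- apply (is_derive_trace (n := n)); assumption || lra.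
Qed.

Lemma filterlim_seq_within (P : R -> Prop) (xs : nat -> R) (x : R) :
  is_lim_seq xs x -> (forall n, P (xs n)) ->
  filterlim xs eventually (within P (locally x)).
Proof.
intros hx hP Q hQ.
assert (h : eventually (fun n => P (xs n) -> Q (xs n))) by exact (hx _ hQ).
unfold filtermap; revert h; apply filter_imp; auto.
Qed.

(** The one-sided limits in [has_jump] and the two-dimensional extensions are evaluated along the
    same horizontal sequences, and limits are unique. The weights allow both the solution and its
    flux. *)
Lemma has_jump_cont_ext (bm bp b c1 c2 am ap y v : R) (phi : R -> R)
    (F : R -> R -> R) :
  bm < b < bp -> c1 < y < c2 ->
  unif_continuous_2d (rect bm b c1 c2) F ->
  unif_continuous_2d (rect b bp c1 c2) F ->
  (forall s, bm < s < b -> phi s = am * F s y) ->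
  (forall s, b < s < bp -> phi s = ap * F s y) ->
  has_jump phi b v ->
  v = ap * cont_ext (rect b bp c1 c2) F b y
      - am * cont_ext (rect bm b c1 c2) F b y.
Proof.
intros hb hy hm hp em ep [vp [vm [lp [lm ->]]]].
assert (inm : forall n, bm < inner_seq bm b b n < b)
  by (intros n; apply inner_seq_in; lra).
assert (inp : forall n, b < inner_seq b bp b n < bp)
  by (intros n; apply inner_seq_in; lra).
f_equal; [| f_equal].
- apply (is_lim_seq_unique_real (v := fun n => phi (inner_seq b bp b n))).
  + refine (filterlim_comp _ _ _ _ phi _ _ _ _ lp).
    apply filterlim_seq_within; [apply is_lim_seq_inner_seq | apply inp].
  + apply is_lim_seq_ext with (fun n => ap * F (inner_seq b bp b n) y).
    { intros n; rewrite ep; [reflexivity | apply inp]. }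
    apply (is_lim_seq_scal_l _ _ (Finite _)).
    apply (is_lim_seq_cont_ext (ys := fun _ => y) hp).
    * intros n; split; [apply inp | exact hy].
    * apply is_lim_seq_inner_seq.
    * apply is_lim_seq_const.
- apply (is_lim_seq_unique_real (v := fun n => phi (inner_seq bm b b n))).
  + refine (filterlim_comp _ _ _ _ phi _ _ _ _ lm).
    apply filterlim_seq_within; [apply is_lim_seq_inner_seq | apply inm].
  + apply is_lim_seq_ext with (fun n => am * F (inner_seq bm b b n) y).
    { intros n; rewrite em; [reflexivity | apply inm]. }
    apply (is_lim_seq_scal_l _ _ (Finite _)).
    apply (is_lim_seq_cont_ext (ys := fun _ => y) hm).
    * intros n; split; [apply inm | exact hy].
    * apply is_lim_seq_inner_seq.
    * apply is_lim_seq_const.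
Qed.

(** * Taylor expansion up to the boundary *)

(** The Lagrange remainder of degree [n - 1] contains the [n]-th derivative at an intermediate
    point. Replacing it by the value at [x] completes the polynomial of degree [n], and the
    oscillation of that derivative bounds the error; no derivative of order [n + 1] is involved. *)
Lemma taylor_right (f : R -> R) (n : nat) (b1 b2 x y M : R) :
  (forall t, b1 < t < b2 -> forall k, (k <= n)%nat -> ex_derive_n f k t) ->
  b1 < x -> x < y -> y < b2 ->
  (forall t, x <= t <= y -> Rabs (Derive_n f n t - Derive_n f n x) <= M) ->
  Rabs (f y - sum_f_R0 (fun m => (y - x) ^ m / INR (fact m) * Derive_n f m x) n)
  <= M * (y - x) ^ n.
Proof.
intros hder hx hxy hy hM.
destruct n as [| n].
- simpl.
  replace (f y - 1 / 1 * f x) with (Derive_n f 0 y - Derive_n f 0 x)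
    by (simpl; field).
  rewrite Rmult_1_r; apply hM; lra.
- destruct (@Taylor_Lagrange f n x y hxy) as [z [hz e]].
  { intros t ht; apply hder; lra. }
  rewrite e; cbn [sum_f_R0].
  replace (_ - _) with ((y - x) ^ S n
    * (/ INR (fact (S n)) * (Derive_n f (S n) z - Derive_n f (S n) x)))
    by (unfold Rdiv; ring).
  assert (hp : 0 <= (y - x) ^ S n) by (apply pow_le; lra).
  rewrite Rabs_mult, (Rabs_pos_eq _ hp), Rmult_comm.
  apply Rmult_le_compat_r; [exact hp |].
  assert (hf : 1 <= INR (fact (S n)))
    by (apply (le_INR 1); apply lt_O_fact).
  assert (hi : 0 < / INR (fact (S n)) <= 1).
  { split; [apply Rinv_0_lt_compat; lra |].
    rewrite <- Rinv_1; apply Rinv_le_contravar; lra. }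
  rewrite Rabs_mult, (Rabs_pos_eq (/ _)) by lra.
  assert (hz' : Rabs (Derive_n f (S n) z - Derive_n f (S n) x) <= M)
    by (apply hM; lra).
  assert (ha := Rabs_pos (Derive_n f (S n) z - Derive_n f (S n) x)).
  nra.
Qed.

(** The case [y < x] follows from the case [x < y] by the reflection of [t] to [- t]: the sign that
    each derivative acquires cancels the sign of the matching power. *)
Lemma taylor_two_sided (f : R -> R) (n : nat) (b1 b2 x y M : R) :
  (forall t, b1 < t < b2 -> forall k, (k <= n)%nat -> ex_derive_n f k t) ->
  b1 < x < b2 -> b1 < y < b2 ->
  (forall t, b1 < t < b2 -> Rabs (t - x) <= Rabs (y - x) ->
     Rabs (Derive_n f n t - Derive_n f n x) <= M) ->
  Rabs (f y - sum_f_R0 (fun m => (y - x) ^ m / INR (fact m) * Derive_n f m x) n)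
  <= M * Rabs (y - x) ^ n.
Proof.
intros hder hx hy hM.
destruct (Rtotal_order x y) as [hxy | [<- | hyx]].
- rewrite (Rabs_pos_eq (y - x)) by lra.
  apply taylor_right with b1 b2; try lra; [exact hder |].
  intros t ht; apply hM; [lra |].
  rewrite !Rabs_pos_eq by lra; lra.
- assert (hM0 : 0 <= M).
  { eapply Rle_trans; [apply Rabs_pos | apply (hM x hx)]; lra. }
  assert (e : forall k, sum_f_R0
    (fun m => (x - x) ^ m / INR (fact m) * Derive_n f m x) k = f x).
  { induction k as [| k IH]; [simpl; field |].
    cbn [sum_f_R0]; rewrite IH, Rminus_diag; simpl pow; unfold Rdiv; ring. }
  rewrite e, !Rminus_diag, !Rabs_R0.
  apply Rmult_le_pos; [exact hM0 | apply pow_le; lra].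
- set (g := fun t => f (- t)).
  assert (hl : forall t, b1 < - t < b2 -> forall k, (k <= n)%nat ->
    locally (- t) (fun z => forall j, (j <= k)%nat -> ex_derive_n f j z)).
  { intros t ht k hk; generalize (locally_open_interval ht).
    apply filter_imp; intros z hz j hj; apply hder; [exact hz | lia]. }
  assert (eg : forall t, b1 < - t < b2 -> forall k, (k <= n)%nat ->
    Derive_n g k t = (-1) ^ k * Derive_n f k (- t)).
  { intros t ht k hk; apply Derive_n_comp_opp, hl; assumption. }
  assert (h1 : forall k, Rabs ((-1) ^ k) = 1) by exact pow_1_abs.
  assert (h := @taylor_right g n (- b2) (- b1) (- x) (- y) M).
  assert (sq : forall k, (-1) ^ k * (-1) ^ k = 1).
  { intros k; rewrite <- Rpow_mult_distr.
    replace (-1 * -1) with 1 by ring; apply pow1. }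
  rewrite (sum_eq _
    (fun m => (y - x) ^ m / INR (fact m) * Derive_n f m x)) in h.
  + change (g (- y)) with (f (- - y)) in h; rewrite Ropp_involutive in h.
    rewrite (Rabs_left1 (y - x)) by lra.
    replace (- (y - x)) with (- y - - x) by ring.
    apply h; try lra.
    * intros t ht k hk; apply ex_derive_n_comp_opp, hl; [lra | exact hk].
    * intros t ht; rewrite !eg, Ropp_involutive by (lra || lia).
      rewrite <- Rmult_minus_distr_l, Rabs_mult, h1, Rmult_1_l.
      apply hM; [lra |].
      rewrite !Rabs_left1 by lra; lra.
  + intros m hm; rewrite eg, Ropp_involutive by (lra || lia).
    replace (- y - - x) with (-1 * (y - x)) by ring.
    rewrite Rpow_mult_distr.
    transitivity (((-1) ^ m * (-1) ^ m) * ((y - x) ^ m / INR (fact m)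
      * Derive_n f m x)); [unfold Rdiv; ring |].
    rewrite sq; ring.
Qed.

Lemma sum_f_R0_mul_sub (a b c : nat -> R) (n : nat) :
  sum_f_R0 (fun k => a k * (b k - c k)) n =
  sum_f_R0 (fun k => a k * b k) n - sum_f_R0 (fun k => a k * c k) n.
Proof. induction n as [| n IH]; simpl; [| rewrite IH]; ring. Qed.

(** The coefficients [d m k] are abstract, so that they can be partial derivatives at an interior
    point as well as their extensions to the closure. *)
Definition taylor_poly (n : nat) (d : nat -> nat -> R) (s t : R) : R :=
  sum_f_R0 (fun k => t ^ k / INR (fact k) *
    sum_f_R0 (fun m => s ^ m / INR (fact m) * d m k) (n - k)) n.

Lemma Rabs_pow_div_fact_le (t e : R) (k : nat) :
  Rabs t <= e -> Rabs (t ^ k / INR (fact k)) <= e ^ k.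
Proof.
intros ht.
assert (hf : 1 <= INR (fact k)) by (apply (le_INR 1); apply lt_O_fact).
assert (hi : 0 < / INR (fact k) <= 1).
{ split; [apply Rinv_0_lt_compat; lra |].
  rewrite <- Rinv_1; apply Rinv_le_contravar; lra. }
unfold Rdiv; rewrite Rabs_mult, (Rabs_pos_eq (/ _)), <- RPow_abs by lra.
assert (h0 : 0 <= Rabs t ^ k) by (apply pow_le, Rabs_pos).
assert (h1 : Rabs t ^ k <= e ^ k)
  by (apply pow_incr; split; [apply Rabs_pos | exact ht]).
nra.
Qed.

(* Expanding in [y] first makes every coefficient a [partial_derive], with no
   exchange of derivatives. *)
Lemma taylor_poly_interior (b1 b2 c1 c2 : R) (n : nat) (F : R -> R -> R)
    (L x y x' y' e : R) :
  (forall x y, rect b1 b2 c1 c2 x y -> ex_diff_n F n x y) ->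
  0 <= L ->
  (forall m k, (m + k = n)%nat -> forall x y x' y',
     rect b1 b2 c1 c2 x y -> rect b1 b2 c1 c2 x' y' ->
     Rabs (partial_derive m k F x y - partial_derive m k F x' y')
     <= L * (Rabs (x - x') + Rabs (y - y'))) ->
  rect b1 b2 c1 c2 x y -> rect b1 b2 c1 c2 x' y' ->
  Rabs (x' - x) <= e -> Rabs (y' - y) <= e ->
  Rabs (F x' y'
        - taylor_poly n (fun m k => partial_derive m k F x y) (x' - x) (y' - y))
  <= L * (INR n + 2) * e ^ S n.
Proof.
intros hdiff hL hlip [hx hy] [hx' hy'] hs ht.
assert (he : 0 <= e) by (eapply Rle_trans; [apply Rabs_pos | exact hs]).
assert (eder : forall m k, (m + k <= n)%nat -> forall x y,
  b1 < x < b2 -> c1 < y < c2 ->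
  ex_derive_n (fun x => partial_derive 0 k F x y) m x).
{ intros [| m] k hmk u v hu hv; [exact I |].
  apply (ex_diff_n_ex_deriv_inf_1 n m k); [lia |].
  apply hdiff; split; assumption. }
(* First the vertical segment at abscissa [x']. The coefficients are then [y]-derivatives at
   [(x', y)], which [hX] expands horizontally, each only to the complementary order [n - k]. *)
assert (hY : Rabs (F x' y' - sum_f_R0
  (fun k => (y' - y) ^ k / INR (fact k) * partial_derive 0 k F x' y) n)
  <= L * e * e ^ n).
{ eapply Rle_trans.
  - apply (@taylor_two_sided (F x') n c1 c2 y y' (L * e)); try assumption.
    + intros t htc [| k] hk; [exact I |].
      apply (ex_diff_n_ex_deriv_inf_2 n 0 k); [lia |].
      apply hdiff; split; assumption.
    + intros t htc htt.
      eapply Rle_trans; [apply (hlip 0%nat n); [reflexivity | |]; split; lra |].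
      rewrite Rminus_diag, Rabs_R0; apply Rmult_le_compat_l; lra.
  - apply Rmult_le_compat_l; [apply Rmult_le_pos; assumption |].
    apply pow_incr; split; [apply Rabs_pos | exact ht]. }
assert (hX : forall k, (k <= n)%nat -> Rabs (partial_derive 0 k F x' y - sum_f_R0
  (fun m => (x' - x) ^ m / INR (fact m) * partial_derive m k F x y) (n - k))
  <= L * e * e ^ (n - k)).
{ intros k hk.
  eapply Rle_trans.
  - apply (@taylor_two_sided (fun x => partial_derive 0 k F x y) (n - k)
      b1 b2 x x' (L * e)); try assumption.
    + intros t htb m hm; apply eder; assumption || lia.
    + intros t htb htt.
      eapply Rle_trans; [apply (hlip (n - k)%nat k); [lia | |]; split; lra |].
      rewrite Rminus_diag, Rabs_R0; apply Rmult_le_compat_l; lra.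
  - apply Rmult_le_compat_l; [apply Rmult_le_pos; assumption |].
    apply pow_incr; split; [apply Rabs_pos | exact hs]. }
unfold taylor_poly.
match goal with |- Rabs (_ - ?T) <= _ =>
  replace (F x' y' - T) with
    ((F x' y' - sum_f_R0 (fun k => (y' - y) ^ k / INR (fact k)
        * partial_derive 0 k F x' y) n)
     + sum_f_R0 (fun k => (y' - y) ^ k / INR (fact k)
        * (partial_derive 0 k F x' y - sum_f_R0 (fun m =>
            (x' - x) ^ m / INR (fact m) * partial_derive m k F x y) (n - k))) n)
end.
2:{ rewrite sum_f_R0_mul_sub; ring. }
eapply Rle_trans; [apply Rabs_triang |].
(* The factor [INR n + 2] counts one vertical remainder and [n + 1] horizontal ones, each at most
   [L * e ^ S n]. *)
replace (L * (INR n + 2) * e ^ S n)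
  with (L * e * e ^ n + L * e ^ S n * INR (S n))
  by (rewrite S_INR; simpl; ring).
apply Rplus_le_compat; [exact hY |].
eapply Rle_trans; [apply sum_f_R0_triangle |].
rewrite <- sum_cte.
apply sum_Rle; intros k hk.
rewrite Rabs_mult.
replace (L * e ^ S n) with (e ^ k * (L * e * e ^ (n - k))).
- apply Rmult_le_compat; try apply Rabs_pos.
  + apply Rabs_pow_div_fact_le; exact ht.
  + apply hX; exact hk.
- replace (S n) with (S (k + (n - k))) by lia.
  simpl; rewrite pow_add; ring.
Qed.

(** * Passage of the Taylor bound to the closure *)

Lemma is_lim_seq_sum_f_R0 (v : nat -> nat -> R) (l : nat -> R) (N : nat) :
  (forall k, (k <= N)%nat -> is_lim_seq (v k) (l k)) ->
  is_lim_seq (fun n => sum_f_R0 (fun k => v k n) N) (sum_f_R0 l N).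
Proof.
induction N as [| N IH]; intros h; simpl.
- apply h; lia.
- apply is_lim_seq_plus'; [apply IH; intros k hk |]; apply h; lia.
Qed.

Lemma is_lim_seq_pow (v : nat -> R) (l : R) (k : nat) :
  is_lim_seq v l -> is_lim_seq (fun n => v n ^ k) (l ^ k).
Proof.
intros hv; induction k as [| k IH]; simpl.
- apply is_lim_seq_const.
- apply is_lim_seq_mult'; assumption.
Qed.

Lemma is_lim_seq_taylor_poly (n : nat) (d : nat -> nat -> nat -> R)
    (dl : nat -> nat -> R) (s t : nat -> R) (sl tl : R) :
  (forall m k, (m + k <= n)%nat -> is_lim_seq (d m k) (dl m k)) ->
  is_lim_seq s sl -> is_lim_seq t tl ->
  is_lim_seq (fun i => taylor_poly n (fun m k => d m k i) (s i) (t i))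
    (taylor_poly n dl sl tl).
Proof.
intros hd hs ht; unfold taylor_poly.
apply (is_lim_seq_sum_f_R0 (v := fun k i => t i ^ k / INR (fact k) *
  sum_f_R0 (fun m => s i ^ m / INR (fact m) * d m k i) (n - k))).
intros k hk; apply is_lim_seq_mult'.
- apply is_lim_seq_mult'; [apply is_lim_seq_pow, ht | apply is_lim_seq_const].
- apply (is_lim_seq_sum_f_R0
    (v := fun m i => s i ^ m / INR (fact m) * d m k i)).
  intros m hm; apply is_lim_seq_mult'.
  + apply is_lim_seq_mult'; [apply is_lim_seq_pow, hs | apply is_lim_seq_const].
  + apply hd; lia.
Qed.

(** For fixed [i], [inner_seq] contracts towards the midpoint. Moving both points inside therefore
    preserves the bound [e] on their distance. *)
Lemma Rabs_inner_seq_sub_le (b1 b2 x x' : R) (i : nat) :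
  Rabs (inner_seq b1 b2 x' i - inner_seq b1 b2 x i) <= Rabs (x' - x).
Proof.
unfold inner_seq.
assert (hn := pos_INR i).
assert (h0 : 0 < / (INR i + 2)) by (apply Rinv_0_lt_compat; lra).
assert (h1 : / (INR i + 2) < 1).
{ rewrite <- Rinv_1; apply Rinv_lt_contravar; lra. }
replace (_ - _) with ((1 - / (INR i + 2)) * (x' - x)) by (field; lra).
rewrite Rabs_mult, Rabs_pos_eq by lra.
assert (ha := Rabs_pos (x' - x)); nra.
Qed.

(** Centre and target are both pushed inside by [inner_seq], the interior bound holds there with the
    same constant, and both sides pass to the limit. This permits a centre on the interface and
    nodes on the boundary of the domain. *)
Lemma taylor_poly_cont_ext (b1 b2 c1 c2 : R) (n : nat) (F : R -> R -> R) (L : R) :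
  b1 < b2 -> c1 < c2 ->
  unif_smooth_2d (rect b1 b2 c1 c2) n F ->
  0 <= L ->
  (forall m k, (m + k = n)%nat -> forall x y x' y',
     rect b1 b2 c1 c2 x y -> rect b1 b2 c1 c2 x' y' ->
     Rabs (partial_derive m k F x y - partial_derive m k F x' y')
     <= L * (Rabs (x - x') + Rabs (y - y'))) ->
  forall x y x' y' e,
  b1 <= x <= b2 -> c1 <= y <= c2 -> b1 <= x' <= b2 -> c1 <= y' <= c2 ->
  Rabs (x' - x) <= e -> Rabs (y' - y) <= e ->
  Rabs (cont_ext (rect b1 b2 c1 c2) F x' y'
        - taylor_poly n
            (fun m k => cont_ext (rect b1 b2 c1 c2) (partial_derive m k F) x y)
            (x' - x) (y' - y))
  <= L * (INR n + 2) * e ^ S n.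
Proof.
intros hb hc [hdiff hunif] hL hlip x y x' y' e hx hy hx' hy' hs ht.
set (X := inner_seq b1 b2 x); set (Y := inner_seq c1 c2 y).
set (X' := inner_seq b1 b2 x'); set (Y' := inner_seq c1 c2 y').
assert (inP : forall i, rect b1 b2 c1 c2 (X i) (Y i))
  by (intros i; split; apply inner_seq_in; assumption).
assert (inQ : forall i, rect b1 b2 c1 c2 (X' i) (Y' i))
  by (intros i; split; apply inner_seq_in; assumption).
assert (lim : is_lim_seq (fun i => Rabs (F (X' i) (Y' i)
    - taylor_poly n (fun m k => partial_derive m k F (X i) (Y i))
        (X' i - X i) (Y' i - Y i)))
  (Rabs (cont_ext (rect b1 b2 c1 c2) F x' y'
    - taylor_poly n
        (fun m k => cont_ext (rect b1 b2 c1 c2) (partial_derive m k F) x y)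
        (x' - x) (y' - y)))).
{ apply (is_lim_seq_abs _ (Finite _)), is_lim_seq_minus'.
  - apply is_lim_seq_cont_ext; try assumption; try apply is_lim_seq_inner_seq.
    apply (hunif 0%nat 0%nat); lia.
  - apply (is_lim_seq_taylor_poly
      (d := fun m k i => partial_derive m k F (X i) (Y i)));
      [| apply is_lim_seq_minus'; apply is_lim_seq_inner_seq ..].
    intros m k hmk.
    apply is_lim_seq_cont_ext; try assumption; try apply is_lim_seq_inner_seq.
    apply hunif; exact hmk. }
refine (is_lim_seq_le _ _ (Finite _) (Finite _) _ lim (is_lim_seq_const _)).
intros i; apply taylor_poly_interior with b1 b2 c1 c2; try assumption; auto.
- eapply Rle_trans; [apply Rabs_inner_seq_sub_le | exact hs].
- eapply Rle_trans; [apply Rabs_inner_seq_sub_le | exact ht].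
Qed.

(** * The equation and the moments of the stencil *)

Lemma partial_derive_pde (b1 b2 c1 c2 a0 : R) (u f : R -> R -> R) (m n : nat)
    (x y : R) :
  (forall x y, rect b1 b2 c1 c2 x y -> ex_diff_n u 3 x y) ->
  (forall x y, rect b1 b2 c1 c2 x y ->
     f x y = - (a0 * (partial_derive 2 0 u x y + partial_derive 0 2 u x y))) ->
  (m + n <= 1)%nat -> rect b1 b2 c1 c2 x y ->
  partial_derive m n f x y =
  - (a0 * (partial_derive (2 + m) n u x y + partial_derive m (2 + n) u x y)).
Proof.
intros hu hf hmn hxy.
assert (hl := rect_open hxy).
destruct m as [| [| m]], n as [| [| n]]; try lia.
- exact (hf _ _ hxy).
- change (Derive (fun t => f x t) y = - (a0 *
    (partial_derive 2 1 u x y + partial_derive 0 3 u x y))).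
  assert (h3 : locally_2d (ex_diff_n u 3) x y).
  { generalize hl; apply locally_2d_impl, locally_2d_forall; exact hu. }
  (* Only the derivative in [y] needs commuted mixed derivatives; in the case [m = 1] the new
     [x]-derivative is already outermost. *)
  rewrite <- !Derive_partial_derive by exact h3.
  erewrite Derive_ext_loc.
  2:{ generalize (locally_2d_1d_const_x _ _ _ hl); apply filter_imp.
      intros t ht; exact (hf _ _ ht). }
  apply is_derive_unique.
  apply (is_derive_opp (V := R_NormedModule)), is_derive_scal.
  apply (is_derive_plus (V := R_NormedModule)); apply Derive_correct;
    apply (ex_diff_n_ex_deriv_inf_2 3); auto with arith.
- change (Derive (fun t => f t y) x = - (a0 *
    (partial_derive 3 0 u x y + partial_derive 1 2 u x y))).
  erewrite Derive_ext_loc.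
  2:{ generalize (locally_2d_1d_const_y _ _ _ hl); apply filter_imp.
      intros t ht; exact (hf _ _ ht). }
  apply is_derive_unique.
  apply (is_derive_opp (V := R_NormedModule)), is_derive_scal.
  apply (is_derive_plus (V := R_NormedModule)).
  + apply (Derive_correct (fun t => partial_derive 2 0 u t y));
    apply (ex_diff_n_ex_deriv_inf_1 3); auto with arith.
  + apply (Derive_correct (fun t => partial_derive 0 2 u t y));
    apply (ex_diff_n_ex_deriv_inf_1 3); auto with arith.
Qed.

Lemma cont_ext_pde (b1 b2 c1 c2 a0 : R) (u f : R -> R -> R) (m n : nat)
    (x y : R) :
  b1 < b2 -> c1 < c2 -> b1 <= x <= b2 -> c1 <= y <= c2 ->
  unif_smooth_2d (rect b1 b2 c1 c2) 3 u ->
  unif_smooth_2d (rect b1 b2 c1 c2) 1 f ->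
  (forall x y, rect b1 b2 c1 c2 x y ->
     f x y = - (a0 * (partial_derive 2 0 u x y + partial_derive 0 2 u x y))) ->
  (m + n <= 1)%nat ->
  cont_ext (rect b1 b2 c1 c2) (partial_derive m n f) x y =
  - (a0 * (cont_ext (rect b1 b2 c1 c2) (partial_derive (2 + m) n u) x y
           + cont_ext (rect b1 b2 c1 c2) (partial_derive m (2 + n) u) x y)).
Proof.
intros hb hc hx hy [hu1 hu2] [_ hf] hpde hmn.
assert (inP : forall i, rect b1 b2 c1 c2 (inner_seq b1 b2 x i)
  (inner_seq c1 c2 y i)) by (intros i; split; apply inner_seq_in; assumption).
assert (lim : forall G, unif_continuous_2d (rect b1 b2 c1 c2) G ->
  is_lim_seq (fun i => G (inner_seq b1 b2 x i) (inner_seq c1 c2 y i))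
    (cont_ext (rect b1 b2 c1 c2) G x y)).
{ intros G hG; apply is_lim_seq_cont_ext;
    try assumption; apply is_lim_seq_inner_seq. }
apply (is_lim_seq_unique_real (lim _ (hf m n hmn))).
eapply is_lim_seq_ext.
- intros i; symmetry; exact (partial_derive_pde hu1 hpde hmn (inP i)).
- apply (proj1 (is_lim_seq_opp _ (Finite (a0 * (_ + _))))).
  apply (is_lim_seq_scal_l _ _ (Finite (_ + _))).
  apply is_lim_seq_plus'; apply lim, hu2; lia.
Qed.

(** For fixed [n] there are finitely many derivatives, indexed by [m] alone; their constants are
    merged by successive maxima starting from 0, which also makes the result nonnegative. *)
Lemma lipschitz_partials (A : R -> R -> Prop) (F : R -> R -> R) (n : nat) :
  (forall m k, (m + k = n)%nat -> lipschitz_2d A (partial_derive m k F)) ->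
  exists L, 0 <= L /\ forall m k, (m + k = n)%nat -> forall x y x' y',
    A x y -> A x' y' ->
    Rabs (partial_derive m k F x y - partial_derive m k F x' y')
    <= L * (Rabs (x - x') + Rabs (y - y')).
Proof.
intros h.
assert (hN : forall N, exists L, 0 <= L /\
  forall m k, (m + k = n)%nat -> (m < N)%nat -> forall x y x' y',
    A x y -> A x' y' ->
    Rabs (partial_derive m k F x y - partial_derive m k F x' y')
    <= L * (Rabs (x - x') + Rabs (y - y'))).
{ induction N as [| N [L [hL IH]]]; [exists 0; split; [lra | lia] |].
  destruct (Nat.le_gt_cases N n) as [hNn | hNn].
  - destruct (h N (n - N)%nat) as [L' hL']; [lia |].
    exists (Rmax L L'); split; [eapply Rle_trans; [exact hL | apply Rmax_l] |].
    intros m k hmk hm x y x' y' hA hA'.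
    assert (hp : 0 <= Rabs (x - x') + Rabs (y - y'))
      by (apply Rplus_le_le_0_compat; apply Rabs_pos).
    destruct (Nat.eq_dec m N) as [-> | hne].
    + replace k with (n - N)%nat by lia.
      eapply Rle_trans; [apply hL'; assumption |].
      apply Rmult_le_compat_r; [exact hp | apply Rmax_r].
    + eapply Rle_trans; [apply IH; assumption || lia |].
      apply Rmult_le_compat_r; [exact hp | apply Rmax_l].
  - exists L; split; [exact hL |].
    intros m k hmk hm; apply IH; [exact hmk | lia]. }
destruct (hN (S n)) as [L [hL hbound]].
exists L; split; [exact hL |].
intros m k hmk; apply hbound; [exact hmk | lia].
Qed.

Lemma Lh_sub_le (C v v' : Z -> Z -> R) (B : R) :
  (forall k l, (-1 <= k <= 1)%Z -> (-1 <= l <= 1)%Z ->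
     Rabs (v k l - v' k l) <= B) ->
  Rabs (Lh C v - Lh C v') <= Lh (fun k l => Rabs (C k l)) (fun _ _ => B).
Proof.
intros h.
assert (ht : forall k l, (-1 <= k <= 1)%Z -> (-1 <= l <= 1)%Z ->
  Rabs (C k l * v k l - C k l * v' k l) <= Rabs (C k l) * B).
{ intros k l hk hl; rewrite <- Rmult_minus_distr_l, Rabs_mult.
  apply Rmult_le_compat_l; [apply Rabs_pos | apply h; assumption]. }
assert (hsum : forall g g' e : Z -> R,
  (forall k, (-1 <= k <= 1)%Z -> Rabs (g k - g' k) <= e k) ->
  Rabs (sum_pm1 g - sum_pm1 g') <= sum_pm1 e).
{ intros g g' e he; unfold sum_pm1.
  assert (h1 := he (-1)%Z ltac:(lia)).
  assert (h2 := he 0%Z ltac:(lia)).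
  assert (h3 := he 1%Z ltac:(lia)).
  apply Rabs_le_between in h1, h2, h3; apply Rabs_le_between; lra. }
unfold Lh; apply hsum; intros k hk; apply hsum; intros l hl.
apply ht; assumption.
Qed.

(** The four moment weights are the polynomials [G] with indices (0,0), (1,0), (0,2) and (1,2),
    freed of [h]; those with odd second index vanish by the symmetry of [C] in [l]. The factor
    [kappa] comes from the flux jump: on the left, the [x]-derivative is [a2 / a1] times that on the
    right, up to data. *)
Lemma Lh_moments (C : Z -> Z -> R) (w h a1 a2 : R) (u1 u2 f1 f2 : nat -> nat -> R)
    (phi psi : nat -> R) :
  a1 <> 0 -> a2 <> 0 -> (forall k, C k (-1)%Z = C k 1%Z) ->
  (forall m n, (m + n <= 1)%nat ->
     f1 m n = - (a1 * (u1 (2 + m)%nat n + u1 m (2 + n)%nat))) ->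
  (forall m n, (m + n <= 1)%nat ->
     f2 m n = - (a2 * (u2 (2 + m)%nat n + u2 m (2 + n)%nat))) ->
  (forall n, (n <= 3)%nat -> phi n = u2 0%nat n - u1 0%nat n) ->
  (forall n, (n <= 2)%nat -> psi n = a2 * u2 1%nat n - a1 * u1 1%nat n) ->
  let kappa k := if (k <? 0)%Z then a2 / a1 else 1 in
  Lh C (fun _ _ => 1) = 0 ->
  Lh C (fun k l => kappa k * (w + IZR k)) = 0 ->
  Lh C (fun k l => IZR l ^ 2 / 2 - (w + IZR k) ^ 2 / 2) = 0 ->
  Lh C (fun k l => kappa k *
    ((w + IZR k) * IZR l ^ 2 / 2 - (w + IZR k) ^ 3 / 6)) = 0 ->
  Lh C (fun k l => taylor_poly 3 (if (k <? 0)%Z then u1 else u2)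
          (w * h + IZR k * h) (IZR l * h)) =
  / a1 * sum_Lambda 1 (fun m n => f1 m n * Hw_minus C w h m n)
  + / a2 * sum_Lambda 1 (fun m n => f2 m n * Hw_plus C w h m n)
  - sum_f 0 3 (fun n => phi n * Gw C w h 0 n)
  - / a1 * sum_f 0 2 (fun n => psi n * Gw C w h 1 n).
Proof.
intros ha1 ha2 hsym hf1 hf2 hphi hpsi kappa m00 m10 m02 m12.
apply Rminus_diag_uniq.
(* The whole residual, written with the derivatives of [u2] that survive the elimination. *)
transitivity (u2 0%nat 0%nat * Lh C (fun _ _ => 1)
  + u2 1%nat 0%nat * h * Lh C (fun k l => kappa k * (w + IZR k))
  + u2 0%nat 2%nat * h ^ 2
      * Lh C (fun k l => IZR l ^ 2 / 2 - (w + IZR k) ^ 2 / 2)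
  + u2 1%nat 2%nat * h ^ 3 * Lh C (fun k l => kappa k *
      ((w + IZR k) * IZR l ^ 2 / 2 - (w + IZR k) ^ 3 / 6))).
2:{ rewrite m00, m10, m02, m12; ring. }
clear m00 m10 m02 m12.
unfold sum_Lambda, Hw_minus, Hw_plus, Gw, Lh, sum_pm1, kappa.
assert (G00 : forall x y, Gpoly 0 0 x y = 1)
  by (intros; unfold Gpoly; cbn; field).
assert (G01 : forall x y, Gpoly 0 1 x y = y)
  by (intros; unfold Gpoly; cbn; field).
assert (G02 : forall x y, Gpoly 0 2 x y = y ^ 2 / 2 - x ^ 2 / 2)
  by (intros; unfold Gpoly; cbn; field).
assert (G03 : forall x y, Gpoly 0 3 x y = y ^ 3 / 6 - x ^ 2 * y / 2)
  by (intros; unfold Gpoly; cbn; field).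
assert (G10 : forall x y, Gpoly 1 0 x y = x)
  by (intros; unfold Gpoly; cbn; field).
assert (G11 : forall x y, Gpoly 1 1 x y = x * y)
  by (intros; unfold Gpoly; cbn; field).
assert (G12 : forall x y, Gpoly 1 2 x y = x * y ^ 2 / 2 - x ^ 3 / 6)
  by (intros; unfold Gpoly; cbn; field).
assert (H00 : forall x y, Hpoly 0 0 x y = - x ^ 2 / 2)
  by (intros; unfold Hpoly; cbn; field).
assert (H01 : forall x y, Hpoly 0 1 x y = - x ^ 2 * y / 2)
  by (intros; unfold Hpoly; cbn; field).
assert (H10 : forall x y, Hpoly 1 0 x y = - x ^ 3 / 6)
  by (intros; unfold Hpoly; cbn; field).
assert (T : forall d s t, taylor_poly 3 d s t =
  d 0%nat 0%nat + s * d 1%nat 0%nat + t * d 0%nat 1%nat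
  + s ^ 2 / 2 * d 2%nat 0%nat + s * t * d 1%nat 1%nat + t ^ 2 / 2 * d 0%nat 2%nat
  + s ^ 3 / 6 * d 3%nat 0%nat + s ^ 2 * t / 2 * d 2%nat 1%nat
  + s * t ^ 2 / 2 * d 1%nat 2%nat + t ^ 3 / 6 * d 0%nat 3%nat)
  by (intros; unfold taylor_poly; cbn; field).
cbn [Z.ltb Z.compare].
rewrite !T; unfold sum_f; cbn [sum_f_R0 Nat.sub Nat.add].
rewrite !G00, !G01, !G02, !G03, !G10, !G11, !G12, !H00, !H01, !H10, !hsym.
(* Instead of solving for derivatives of [u1], the data are replaced by the derivatives they stand
   for; a rational identity remains. *)
rewrite !hphi, !hpsi, !hf1, !hf2 by lia; cbn [Nat.add].
field; split; assumption.
Qed.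

(** * Signs of the coefficients *)

Lemma div_nonpos_iff (x b : R) : 0 < b -> (x / b <= 0 <-> x <= 0).
Proof.
intros hb; split; intros h.
- replace x with (x / b * b) by (field; lra). nra.
- assert (hi := Rinv_0_lt_compat _ hb). unfold Rdiv; nra.
Qed.

Lemma root_le_iff (s t x : R) : s < 0 -> (- (t / s) <= x <-> s * x + t <= 0).
Proof.
intros hs.
assert (e : s * (- (t / s)) = - t) by (field; lra).
split; intros h; nra.
Qed.

Lemma le_root_iff (r t x : R) : 0 < r -> (x <= - (t / r) <-> r * x + t <= 0).
Proof.
intros hr.
assert (e : r * (- (t / r)) = - t) by (field; lra).
split; intros h; nra.
Qed.

(** * Polynomial inequalities for the coefficients of the stencil *)

Ltac unfold_coefficients :=
  unfold beta, r1, r2, r3, r4, r5, s1, s2, s3, s4, s5, s6, s7, s8,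
    t1, t2, t3, t4, t5, t6, t7, t8, t9, t10 in *.

Lemma mobius_param (w : R) : 0 < w < 1 -> exists x, 0 < x /\ w = x / (1 + x).
Proof.
intros hw; exists (w / (1 - w)); split.
- apply Rdiv_lt_0_compat; lra.
- field; lra.
Qed.

Ltac sum_of_positives :=
  match goal with
  | |- 0 < _ + _ => apply Rplus_lt_0_compat; sum_of_positives
  | |- 0 < _ * _ => apply Rmult_lt_0_compat; sum_of_positives
  | |- 0 < _ / _ => apply Rdiv_lt_0_compat; sum_of_positives
  | |- 0 < _ ^ _ => apply pow_lt; sum_of_positives
  | |- _ => lra
  end.

(** Once [w] is replaced by [x / (1 + x)], the difference of the two sides simplifies to a quotient
    whose numerator and denominator are built from positive terms, so positivity can be read off
    termwise. *)
Ltac solve_polynomial_sign :=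
  let x := fresh "x" in
  intros; unfold_coefficients;
  match goal with hw : 0 < ?w < 1 |- _ =>
    destruct (mobius_param hw) as [x [? ->]]; clear hw end;
  apply Rlt_0_minus; field_simplify; [sum_of_positives | lra].

Lemma beta_pos (w al : R) : 0 < w < 1 -> 0 < al -> 0 < beta w al.
Proof. solve_polynomial_sign. Qed.

(* The coefficients off the centre, times [beta], are [slope * rho + offset]. *)
Definition corner_slope (w al : R) := r4 w * al ^ 2 + r5 w * al.
Definition corner_offset (w al : R) := t1 w * al ^ 2 + t2 w * al.

Definition vertical_slope (w al : R) := s1 w + s2 w * al ^ 2 + s3 w * al.
Definition vertical_offset (w al : R) := t3 w + t4 w * al ^ 2 + t5 w * al.

Definition left_slope (w al : R) := s4 w * al ^ 2 + s5 w * al.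
Definition left_offset (w al : R) := t6 w * al ^ 2 + t7 w * al.

Definition right_slope (w al : R) := s6 w + s7 w * al ^ 2 + s8 w * al.
Definition right_offset (w al : R) := t8 w + t9 w * al ^ 2 + t10 w * al.

Ltac unfold_lines :=
  unfold corner_slope, corner_offset, vertical_slope, vertical_offset,
    left_slope, left_offset, right_slope, right_offset in *.

Lemma corner_slope_pos (w al : R) : 0 < w < 1 -> 0 < al ->
  0 < corner_slope w al.
Proof. unfold_lines; solve_polynomial_sign. Qed.

Lemma vertical_slope_neg (w al : R) : 0 < w < 1 -> 0 < al ->
  vertical_slope w al < 0.
Proof. unfold_lines; solve_polynomial_sign. Qed.

(** Together with the negative slope this makes the root in [rho] negative, hence below the bound 0
    in [rho_max]; likewise for the left and right coefficients. *)
Lemma vertical_offset_neg (w al : R) : 0 < w < 1 -> 0 < al ->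
  vertical_offset w al < 0.
Proof. unfold_lines; solve_polynomial_sign. Qed.

(** Cleared of denominators: the root of the vertical coefficient lies below that of the corner
    coefficient. The slopes have opposite signs, which fixes the direction of the inequality. *)
Lemma vertical_cross (w al : R) : 0 < w < 1 -> 0 < al ->
  vertical_offset w al * corner_slope w al
  < vertical_slope w al * corner_offset w al.
Proof. unfold_lines; solve_polynomial_sign. Qed.

Lemma left_slope_neg (w al : R) : 0 < w < 1 -> 0 < al ->
  left_slope w al < 0.
Proof. unfold_lines; solve_polynomial_sign. Qed.

Lemma left_offset_neg (w al : R) : 0 < w < 1 -> 0 < al ->
  left_offset w al < 0.
Proof. unfold_lines; solve_polynomial_sign. Qed.

Lemma left_cross (w al : R) : 0 < w < 1 -> 0 < al ->
  left_offset w al * corner_slope w al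
  < left_slope w al * corner_offset w al.
Proof. unfold_lines; solve_polynomial_sign. Qed.

Lemma right_slope_neg (w al : R) : 0 < w < 1 -> 0 < al ->
  right_slope w al < 0.
Proof. unfold_lines; solve_polynomial_sign. Qed.

Lemma right_offset_neg (w al : R) : 0 < w < 1 -> 0 < al ->
  right_offset w al < 0.
Proof. unfold_lines; solve_polynomial_sign. Qed.

Lemma right_cross (w al : R) : 0 < w < 1 -> 0 < al ->
  right_offset w al * corner_slope w al
  < right_slope w al * corner_offset w al.
Proof. unfold_lines; solve_polynomial_sign. Qed.

(** One lower end against both upper ends; three uses give a nonempty interval. *)
Lemma root_le_roots (s t r c : R) :
  s < 0 -> t < 0 -> 0 < r -> t * r < s * c ->
  - (t / s) <= Rmin 0 (- (c / r)).
Proof.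
intros hs ht hr hc; apply Rmin_glb.
- apply root_le_iff; [exact hs | lra].
- apply root_le_iff; [exact hs |].
  replace (s * - (c / r) + t) with ((t * r - s * c) / r) by (field; lra).
  apply div_nonpos_iff; lra.
Qed.

Lemma rho_interval_nonempty (w al : R) : 0 < w < 1 -> 0 < al ->
  rho_min w al <= rho_max w al.
Proof.
intros hw ha.
assert (hr := corner_slope_pos hw ha).
repeat apply Rmax_lub; apply root_le_roots; try exact hr.
- exact (vertical_slope_neg hw ha).
- exact (vertical_offset_neg hw ha).
- exact (vertical_cross hw ha).
- exact (left_slope_neg hw ha).
- exact (left_offset_neg hw ha).
- exact (left_cross hw ha).
- exact (right_slope_neg hw ha).
- exact (right_offset_neg hw ha).
- exact (right_cross hw ha).
Qed.

(** * The sign condition as a system of linear inequalities in [rho] *)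

Lemma Rmax_le_iff (x y z : R) : Rmax x y <= z <-> x <= z /\ y <= z.
Proof.
split.
- intros h; split; (eapply Rle_trans; [| exact h]).
  + apply Rmax_l.
  + apply Rmax_r.
- intros [hx hy]; apply Rmax_lub; assumption.
Qed.

Lemma Rmin_ge_iff (x y z : R) : z <= Rmin x y <-> z <= x /\ z <= y.
Proof.
split.
- intros h; split; (eapply Rle_trans; [exact h |]).
  + apply Rmin_l.
  + apply Rmin_r.
- intros [hx hy]; apply Rmin_glb; assumption.
Qed.

Lemma stencil_left (w al rho : R) : stencil w al rho (-1)%Z 0%Z =
  (left_slope w al * rho + left_offset w al) / beta w al.
Proof. simpl; unfold_lines; f_equal; ring. Qed.

Lemma stencil_right (w al rho : R) : stencil w al rho 1%Z 0%Z =
  (right_slope w al * rho + right_offset w al) / beta w al.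
Proof. simpl; unfold_lines; f_equal; ring. Qed.

Lemma stencil_vertical (w al rho : R) : stencil w al rho 0%Z 1%Z =
  (vertical_slope w al * rho + vertical_offset w al) / beta w al.
Proof. simpl; unfold_lines; f_equal; ring. Qed.

Lemma stencil_corner (w al rho : R) : stencil w al rho (-1)%Z 1%Z =
  (corner_slope w al * rho + corner_offset w al) / beta w al.
Proof. simpl; unfold_lines; f_equal; ring. Qed.

(** The reflection of [l] to [- l] reduces eight inequalities to five, grouped as three lower and
    two upper bounds on [rho]. *)
Lemma sign_condition_stencil (w al rho : R) :
  sign_condition (stencil w al rho) <->
  (stencil w al rho 0%Z 1%Z <= 0 /\ stencil w al rho (-1)%Z 0%Z <= 0 /\
   stencil w al rho 1%Z 0%Z <= 0) /\
  (rho <= 0 /\ stencil w al rho (-1)%Z 1%Z <= 0).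
Proof.
split.
- intros [_ h].
  assert (h11 := h 1%Z 1%Z ltac:(lia) ltac:(lia) ltac:(lia)); simpl in h11.
  repeat split; [apply h; lia .. | exact h11 | apply h; lia].
- intros [[h01 [hl hr]] [h11 hc]]; split; [simpl; lra |].
  intros k l hk hl' hkl.
  assert (ek : (k = -1 \/ k = 0 \/ k = 1)%Z) by lia.
  assert (el : (l = -1 \/ l = 0 \/ l = 1)%Z) by lia.
  destruct ek as [-> | [-> | ->]], el as [-> | [-> | ->]];
    (* The entries at [l = -1] and [l = 1] are convertible, so the same hypotheses close both. *)
    assumption || (exfalso; lia).
Qed.

Lemma sign_condition_iff (w al rho : R) : 0 < w < 1 -> 0 < al ->
  (sign_condition (stencil w al rho) <-> rho_min w al <= rho <= rho_max w al).
Proof.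
intros hw ha.
assert (hb := beta_pos hw ha).
rewrite sign_condition_stencil, stencil_vertical, stencil_left, stencil_right,
  stencil_corner, !div_nonpos_iff by exact hb.
unfold rho_min, rho_max.
rewrite !Rmax_le_iff, Rmin_ge_iff.
rewrite !root_le_iff, le_root_iff;
  [unfold_lines; tauto | apply corner_slope_pos | apply right_slope_neg
   | apply left_slope_neg | apply vertical_slope_neg]; assumption.
Qed.

Lemma stencil_sum_zero (w al rho : R) : 0 < beta w al ->
  sum_condition (stencil w al rho).
Proof.
intros hb; unfold sum_condition, sum_pm1; simpl.
unfold_coefficients; field; lra.
Qed.

(** * Consistency *)

(** Strict interior position forces [0 < i < N]; the neighbouring nodes then stay in the closed
    domain. *)
Lemma grid_neighbours (l h : R) (N i : nat) :
  0 < h -> l < l + INR i * h < l + INR N * h ->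
  l <= l + INR i * h - h /\ l + INR i * h + h <= l + INR N * h.
Proof.
intros hh hi.
assert (h0 : (0 < i)%nat) by (apply INR_lt; simpl; nra).
assert (h1 : (i < N)%nat) by (apply INR_lt; nra).
apply le_INR in h0, h1; rewrite S_INR in h0, h1; simpl in h0; nra.
Qed.

(** Near a point of [Omega D p] the coefficient is constant, so it can be taken out of the
    derivative of the flux. *)
Lemma solution_pde (D : cross_domain) (a u f g : R -> R -> R)
    (ap : label -> R) (phi psi : label -> R -> R) (p : label) :
  p = P1 \/ p = P2 ->
  (forall p x y, Omega D p x y -> a x y = ap p) ->
  is_solution D a f g phi psi u ->
  forall x y, Omega D p x y ->
  f x y = - (ap p * (partial_derive 2 0 u x y + partial_derive 0 2 u x y)).
Proof.
intros hp ha hsol x y hxy.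
assert (hin : in_open D x y).
{ assert (h1 := xi_in D); assert (h2 := zeta_in D).
  destruct hp as [-> | ->]; destruct hxy; split; lra. }
assert (hG : ~ Gamma D x y).
{ intros [[q hq] | hq]; destruct hp as [-> | ->]; destruct hxy;
    try destruct q; simpl in hq; lra. }
assert (hl : locally_2d (Omega D p) x y)
  by (destruct hp as [-> | ->]; exact (rect_open hxy)).
destruct (sol_pde hsol hin hG) as [dx [dy [hdx [hdy <-]]]].
apply is_derive_unique in hdx, hdy.
rewrite <- hdx, <- hdy, Rmult_plus_distr_l.
f_equal; f_equal.
- change (partial_derive 2 0 u x y)
    with (Derive (Derive (fun t => u t y)) x).
  rewrite <- Derive_scal; apply Derive_ext_loc.
  generalize (locally_2d_1d_const_y _ _ _ hl); apply filter_imp.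
  intros t ht; rewrite (ha _ _ _ ht); reflexivity.
- change (partial_derive 0 2 u x y) with (Derive (Derive (u x)) y).
  rewrite <- Derive_scal; apply Derive_ext_loc.
  generalize (locally_2d_1d_const_x _ _ _ hl); apply filter_imp.
  intros t ht; rewrite (ha _ _ _ ht); reflexivity.
Qed.

(** With the centre equal to 1, the right corners equal to [rho] and symmetry in [l], four
    coefficients remain. These four equations are the linear system which the formulas over [beta]
    solve. *)
Lemma stencil_moments (w al rho : R) : 0 < al -> 0 < beta w al ->
  let kappa k := if (k <? 0)%Z then / al else 1 in
  let C := stencil w al rho in
  Lh C (fun _ _ => 1) = 0 /\
  Lh C (fun k l => kappa k * (w + IZR k)) = 0 /\
  Lh C (fun k l => IZR l ^ 2 / 2 - (w + IZR k) ^ 2 / 2) = 0 /\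
  Lh C (fun k l => kappa k *
    ((w + IZR k) * IZR l ^ 2 / 2 - (w + IZR k) ^ 3 / 6)) = 0.
Proof.
intros ha hb kappa C; unfold Lh, sum_pm1, kappa, C; simpl.
unfold_coefficients; repeat split; field; lra.
Qed.

Lemma stencil_consistent (D : cross_domain) (a : R -> R -> R) (ap : label -> R)
    (u f g : R -> R -> R) (phi psi : label -> R -> R) (w rho : R) :
  (forall p, 0 < ap p) ->
  (forall p x y, Omega D p x y -> a x y = ap p) ->
  is_solution D a f g phi psi u ->
  0 < w < 1 ->
  (forall p, p = P1 \/ p = P2 ->
     unif_smooth_2d (Omega D p) 3 u /\ unif_smooth_2d (Omega D p) 1 f) ->
  (forall p m n, p = P1 \/ p = P2 -> (m + n = 3)%nat ->
     lipschitz_2d (Omega D p) (partial_derive m n u)) ->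
  consistency_order D ap f phi psi u (stencil w (ap P1 / ap P2) rho) w 3.
Proof.
intros hap ha hsol hw hsmooth hlip.
destruct (hsmooth P1 (or_introl eq_refl)) as [hu1 hf1].
destruct (hsmooth P2 (or_intror eq_refl)) as [hu2 hf2].
destruct (lipschitz_partials (fun m k => hlip P1 m k (or_introl eq_refl)))
  as [L1 [hL1 hlip1]].
destruct (lipschitz_partials (fun m k => hlip P2 m k (or_intror eq_refl)))
  as [L2 [hL2 hlip2]].
assert (hpde1 := solution_pde (or_introl eq_refl) ha hsol).
assert (hpde2 := solution_pde (or_intror eq_refl) ha hsol).
change (Omega D P1) with (rect (l1 D) (xi D) (zeta D) (l4 D)) in *.
change (Omega D P2) with (rect (xi D) (l2 D) (zeta D) (l4 D)) in *.
assert (hxi := xi_in D); assert (hzeta := zeta_in D).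
assert (hp1 := hap P1); assert (hp2 := hap P2).
assert (hal : 0 < ap P1 / ap P2) by (apply Rdiv_lt_0_compat; assumption).
set (C := stencil w (ap P1 / ap P2) rho).
set (B := Lh (fun k l => Rabs (C k l)) (fun _ _ => 1)).
(* The 5 is [INR n + 2] at [n = 3], and 16 is the fourth power of 2, since the nodes are within
   [2 * h] of the interface point in each coordinate. The estimate holds for every mesh size, so the
   threshold 1 is arbitrary. *)
exists (B * ((L1 + L2) * 5 * 16)), 1; split; [lra |].
intros N1 i j hN1 _ _ _ [hopen [_ [hG hcorner]]].
set (h := mesh D N1) in *.
set (x := grid_x D N1 i) in *; set (y := grid_y D N1 j) in *.
assert (hN : 0 < INR N1) by (apply lt_0_INR; exact hN1).
assert (hh : 0 < h) by (apply Rdiv_lt_0_compat; lra).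
assert (e2 : l2 D = l1 D + INR N1 * h) by (unfold h, mesh; field; lra).
assert (e4 : l4 D = l3 D + INR (N0 D * N1) * h).
{ assert (e := aspect_ratio D).
  rewrite mult_INR; unfold h, mesh.
  replace (_ * _ * _) with (INR (N0 D) * (l2 D - l1 D)) by (field; lra); lra. }
destruct hopen as [hx hy], hG as [ex hyz].
assert (nx : l1 D <= x - h /\ x + h <= l2 D).
{ rewrite e2 in hx |- *; exact (grid_neighbours hh hx). }
assert (ny : l3 D <= y - h /\ y + h <= l4 D).
{ rewrite e4 in hy |- *; exact (grid_neighbours hh hy). }
(* Since [xi D = x - w * h] lies in the open horizontal range of the stencil and [zeta D < y],
   avoiding the cross point leaves only this position. Hence column [k = -1] lies in the closure of
   [Omega D P1] and the other two in that of [Omega D P2]. *)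
assert (hyh : zeta D <= y - h).
{ destruct (Rle_or_lt (zeta D) (y - h)) as [hle | hlt]; [exact hle |].
  exfalso; apply hcorner; rewrite <- ex; split; split; nra. }
set (d1 m n := cont_ext (rect (l1 D) (xi D) (zeta D) (l4 D))
  (partial_derive m n u) (xi D) y).
set (d2 m n := cont_ext (rect (xi D) (l2 D) (zeta D) (l4 D))
  (partial_derive m n u) (xi D) y).
set (T k l := taylor_poly 3 (if (k <? 0)%Z then d1 else d2)
  (w * h + IZR k * h) (IZR l * h)).
(* The right-hand side matches the Taylor polynomials exactly; the only error left is the Taylor
   remainder. *)
assert (eF : rhs D ap f phi psi C w N1 i j = Lh C T).
{ unfold rhs; fold h x y; rewrite ex; symmetry.
  destruct (stencil_moments rho hal (beta_pos hw hal)) as [m00 [m10 [m02 m12]]].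
  rewrite Rinv_div in m10, m12.
  apply Lh_moments with (phi := fun n => Derive_n (phi P1) n y)
    (psi := fun n => Derive_n (psi P1) n y); try assumption; try lra.
  - intros [| k | k]; [reflexivity | destruct k; reflexivity ..].
  - intros m n hmn; apply cont_ext_pde; assumption || lra.
  - intros m n hmn; apply cont_ext_pde; assumption || lra.
  - intros n hn; unfold d1, d2.
    rewrite (Derive_n_trace_jump (n := 3) (m := 0) (am := 1) (ap := 1)
      hxi hu1 hu2 (c1 := zeta D) (c2 := l4 D)); [ring | | exact hn | exact hyz].
    intros t ht.
    destruct (sol_jump hsol (p := P1) (x := xi D) (y := t)) as [hj _];
      [split; [reflexivity | exact ht] |].
    apply (has_jump_cont_ext hxi ht) with (5 := hj).
    + exact (proj2 hu1 0%nat 0%nat ltac:(lia)).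
    + exact (proj2 hu2 0%nat 0%nat ltac:(lia)).
    + intros s _; symmetry; apply Rmult_1_l.
    + intros s _; symmetry; apply Rmult_1_l.
  - intros n hn; unfold d1, d2.
    rewrite (Derive_n_trace_jump (n := 3) (m := 1) (am := ap P1) (ap := ap P2)
      hxi hu1 hu2 (c1 := zeta D) (c2 := l4 D)); [ring | | lia | exact hyz].
    intros t ht.
    destruct (sol_jump hsol (p := P1) (x := xi D) (y := t)) as [_ hj];
      [split; [reflexivity | exact ht] |].
    apply (has_jump_cont_ext hxi ht) with (5 := hj).
    + exact (proj2 hu1 1%nat 0%nat ltac:(lia)).
    + exact (proj2 hu2 1%nat 0%nat ltac:(lia)).
    + intros s hs; rewrite (ha P1); [reflexivity | split; assumption].
    + intros s hs; rewrite (ha P2); [reflexivity | split; assumption]. }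
rewrite eF.
assert (herr : Rabs (Lh C (stencil_values D u N1 i j) - Lh C T)
  <= B * ((L1 + L2) * 5 * (2 * h) ^ 4)).
{ replace (B * ((L1 + L2) * 5 * (2 * h) ^ 4))
    with (Lh (fun k l => Rabs (C k l)) (fun _ _ => (L1 + L2) * 5 * (2 * h) ^ 4))
    by (unfold B, Lh, sum_pm1; ring).
  apply Lh_sub_le; intros k l hk hl.
  assert (bk : -1 <= IZR k <= 1) by (split; apply IZR_le; lia).
  assert (bl : -1 <= IZR l <= 1) by (split; apply IZR_le; lia).
  assert (hh4 : 0 <= (2 * h) ^ 4) by (apply pow_le; lra).
  (* The offset is [(w + IZR k) * h], with [w < 1] and [k] at most 1. *)
  assert (vs : Rabs (x + IZR k * h - xi D) <= 2 * h)
    by (apply Rabs_le_between; nra).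
  assert (vt : Rabs (y + IZR l * h - y) <= 2 * h)
    by (apply Rabs_le_between; nra).
  unfold stencil_values, T; fold h x y.
  replace (w * h + IZR k * h) with (x + IZR k * h - xi D) by lra.
  replace (IZR l * h) with (y + IZR l * h - y) at 2 by ring.
  destruct (Z.ltb_spec k 0) as [hk0 | hk0].
  - replace k with (-1)%Z in * by lia.
    eapply Rle_trans.
    + apply (taylor_poly_cont_ext (proj1 hxi) (proj2 hzeta) hu1 hL1 hlip1
        (e := 2 * h)); try assumption; try lra; nra.
    + simpl INR; apply Rmult_le_compat_r; lra.
  - assert (hk1 : 0 <= IZR k) by (apply IZR_le; exact hk0).
    eapply Rle_trans.
    + apply (taylor_poly_cont_ext (proj2 hxi) (proj2 hzeta) hu2 hL2 hlip2
        (e := 2 * h)); try assumption; try lra; nra.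
    + simpl INR; apply Rmult_le_compat_r; lra. }
rewrite Rabs_mult, Rabs_pos_eq by (left; apply Rinv_0_lt_compat, hh).
(* The division by [h] costs one of the four powers in the remainder and leaves order three. *)
apply Rmult_le_reg_l with h; [exact hh |].
rewrite <- Rmult_assoc, Rinv_r, Rmult_1_l by lra.
eapply Rle_trans; [exact herr |].
right; ring.
Qed.

Theorem theorem3p2 :
  (forall (D : cross_domain) (a : R -> R -> R) (ap : label -> R)
          (u f g : R -> R -> R) (phi psi : label -> R -> R) (w rho : R),
     (forall p, 0 < ap p) ->
     (forall p x y, Omega D p x y -> a x y = ap p) ->
     is_solution D a f g phi psi u ->
     0 < w < 1 ->
     (forall p, p = P1 \/ p = P2 ->
        unif_smooth_2d (Omega D p) 3 u /\ unif_smooth_2d (Omega D p) 1 f) ->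
     unif_smooth_1d (fun y => zeta D < y < l4 D) 3 (phi P1) ->
     unif_smooth_1d (fun y => zeta D < y < l4 D) 2 (psi P1) ->
     (forall p m n, p = P1 \/ p = P2 -> (m + n = 3)%nat ->
        lipschitz_2d (Omega D p) (partial_derive m n u)) ->
     consistency_order D ap f phi psi u
       (stencil w (ap P1 / ap P2) rho) w 3)
  /\
  (forall a1 a2 w : R, 0 < a1 -> 0 < a2 -> 0 < w < 1 ->
     let alpha := a1 / a2 in
     0 < beta w alpha /\
     (forall rho : R, sum_condition (stencil w alpha rho)) /\
     rho_min w alpha <= rho_max w alpha /\
     (forall rho : R,
        sign_condition (stencil w alpha rho) <->
        rho_min w alpha <= rho <= rho_max w alpha)).
Proof.
split.
- intros D a ap u f g phi psi w rho hap ha hsol hw hsmooth _ _ hlip.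
  exact (stencil_consistent rho hap ha hsol hw hsmooth hlip).
- intros a1 a2 w ha1 ha2 hw alpha.
  assert (hal : 0 < alpha) by (apply Rdiv_lt_0_compat; assumption).
  assert (hb := beta_pos hw hal).
  split; [exact hb |].
  split; [intros rho; exact (stencil_sum_zero rho hb) |].
  split; [exact (rho_interval_nonempty hw hal) |].
  intros rho; exact (sign_condition_iff rho hw hal).
Qed.
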